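(* Let $M$ be a finite connected matroid on the set $E$ with positive rank $n=r(M)$, let $K$ be an arbitrary field, and let $\hat Z_M(q,\mathbf{v})$ be the multivariate Tutte polynomial of $M$, regarded as a polynomial in $q$ over the field $K(\mathbf{v})$. Then the Galois group of $\hat Z_M(q,\mathbf{v})$ over $K(\mathbf{v})$ is the symmetric group on the $n$ roots of $\hat Z_M(q,\mathbf{v})$.
   Context: Let $M$ be a finite matroid on the ground set $E$ with rank function $r_M$; its rank is $r(M)=r_M(E)$. A matroid is connected if any two distinct elements of its ground set lie in a common circuit (equivalently, it is not a direct sum of two matroids on non-empty ground sets). For each $e\in E$ let $v_e$ be a variable, with all these variables algebraically independent over $K$, and let $\mathbf{v}=\{v_e\}_{e\in E}$. With a further variable $q$, the multivariate Tutte polynomial of $M$ is $$\hat Z_M(q,\mathbf{v})=\sum_{A\subseteq E}q^{\,r(M)-r_M(A)}\prod_{e\in A}v_e,$$ with integer coefficients interpreted in $K$. It has degree $r(M)$ in $q$. The Galois group of a polynomial $f$ over a field $F$ is the Galois group over $F$ of a splitting field of $f$ over $F$, acting as a permutation group on the roots of $f$. The theorem thus says that $\hat Z_M$ has $n$ distinct roots in a splitting field over $K(\mathbf{v})$ and that every permutation of these roots is induced by a $K(\mathbf{v})$-automorphism of the splitting field. *)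

(* Defs.v *)
From HB Require Import structures.
From mathcomp Require Import all_boot all_order all_algebra all_fingroup.
From mathcomp Require Import all_field.
From mathcomp Require Import fraction.
From mathcomp Require Import mpoly.

Set Implicit Arguments.
Unset Strict Implicit.
Unset Printing Implicit Defensive.

Import GRing.Theory.
Local Open Scope ring_scope.

Record matroid (E : finType) := Matroid {
  indep : {set {set E}};
  indep_set0 : set0 \in indep;
  indep_sub : forall I J : {set E}, I \subset J -> J \in indep -> I \in indep;
  indep_augment : forall I J : {set E}, I \in indep -> J \in indep ->
    (#|I| < #|J|)%N -> exists2 e, e \in J :\: I & e |: I \in indep
}.

Definition mrank (E : finType) (M : matroid E) (A : {set E}) : nat :=
  \max_(I in indep M | I \subset A) #|I|.

Definition rk (E : finType) (M : matroid E) : nat := mrank M [set: E].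

Definition circuit (E : finType) (M : matroid E) (C : {set E}) : bool :=
  minset [pred D : {set E} | D \notin indep M] C.

Definition mconnected (E : finType) (M : matroid E) : Prop :=
  forall e f : E, e != f ->
    exists C : {set E}, [/\ circuit M C, e \in C & f \in C].

(* The field K(v): the polynomial variables are indexed by 'I_#|E|, hence by E
   through enum_rank. *)
Definition ratfun (E : finType) (K : fieldType) : fieldType :=
  {fraction {mpoly K[#|E|]}}.

Definition var (E : finType) (K : fieldType) (e : E) : ratfun E K :=
  tofrac ('X_(enum_rank e) : {mpoly K[#|E|]}).

(* The polynomial variable 'X is q. The truncated subtraction is harmless, as
   mrank M A <= rk M. *)
Definition mv_tutte (E : finType) (M : matroid E) (K : fieldType) :
    {poly ratfun E K} :=
  \sum_(A : {set E}) (\prod_(e in A) var K e) *: 'X^(rk M - mrank M A).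

(* The permutations of the (indices of the) entries of rs that are induced by
   F-automorphisms of L; when rs lists without repetition the roots of a
   polynomial with splitting field L over F, this is the Galois group of that
   polynomial, as a permutation group on its roots. *)
Definition gal_perms (F : fieldType) (L : splittingFieldType F) (n : nat)
    (rs : n.-tuple L) : {set 'S_n} :=
  [set s : 'S_n | [exists g in 'Gal({:L} / 1)%g,
     [forall i, g (tnth rs i) == tnth rs (s i)]]].

(* Main.v *)
Require Import Defs.
From HB Require Import structures.
From mathcomp Require Import all_boot all_order all_algebra all_fingroup.
From mathcomp Require Import all_field.
From mathcomp Require Import fraction.
From mathcomp Require Import mpoly.
From mathcomp Require Import zify.
From Stdlib Require Import Classical_Prop.

Set Implicit Arguments.
Unset Strict Implicit.
Unset Printing Implicit Defensive.

Import GRing.Theory.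
Local Open Scope ring_scope.

(** Call a monic polynomial of degree [n] full when its roots [x_1, ..., x_n] are
    distinct and each [x_(j+1)] has degree [n - j] over the field generated by
    the base field and [x_1, ..., x_j].  This is the largest degree possible, and
    it makes the Galois group symmetric: any injective assignment of values to
    the first roots is realized by automorphisms, one root at a time
    ([full_tower_transitive]).  Moreover, the definition involves no
    automorphism, so it can be compared between different fields.

    The comparison is by specialization along a place ([full_specialize],
    [full_galois_specialize]): if the coefficients of a monic [f] are finite at a
    place, and the reduction of [f] is full over the residue field, then [f] is
    full.  Indeed, by the Gauss lemma for valuation rings ([gauss_monic]) a monic
    factor of [f] reduces to a factor of its reduction, so [f] is irreducible; the
    place then extends to the field generated by one root [x], sending [x] to a
    root [y] of the reduction ([adjoin_place_minPoly]), and one goes on with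
    [f / (X - x)] and its reduction divided by [X - y].

    For an element [e] which is neither a loop nor a coloop,
    [Z_M = Z_(M\e) + v_e Z_(M/e)], and by a theorem of Tutte one of the minors is
    connected if [M] is ([connected_minor], proved by uncrossing separations).
    One therefore argues by induction on the number of elements.

    If [M\e] is connected, the place [v_e = 0] reduces [Z_M] to [Z_(M\e)], which
    has the same degree, and one concludes by specialization
    ([full_galois_pencil0]).

    If only [M/e] is known to be connected, put [P = Z_(M\e)] and
    [Q = Z_(M/e)], of degrees [n] and [n - 1].  The roots of [P + T Q] tend to
    those of [Q] for [T] tending to infinity, except one which escapes to
    infinity; this accounts for all permutations of [n - 1] of the roots
    ([full_galois_infinity]).  To make this algebraic, adjoin one root [a] of
    [P + T Q]: since [T = - P(a) / Q(a)], the field [k(T, a)] is just [k(a)], a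
    field of rational functions in [a], over which the other roots are those of
    [g = (P - (P(a) / Q(a)) Q) / (X - a)]; at the place [a = oo] the polynomial
    [g] reduces to [Q], so it is full.  What remains is that [P + T Q] is
    irreducible.  A proper factorization maps to one of [(X - a) g] with [g]
    irreducible, so it would have a linear factor; but [P + T Q] has no root in
    [k(T)] when [P] and [Q] are coprime ([pencil_no_root]).

    Finally, [Q] is irreducible, so coprimality means that [Q] does not divide [P].
    If it did, it would still do so when all variables outside a set [C] are
    set to [0], where [C] together with [e] is a circuit.  Then [P] is the product
    of the [X + v_f], [Q] has a closed form as well, and the quotient would have
    to vanish at [- v_f] for each of the at least two elements [f] of [C]
    ([contraction_not_dvd_deletion]). *)

(** * Places *)

(** A ring homomorphism from a subring of [A] to [B] is handled through its
    graph: this spares subring types, and extending the homomorphism to a new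
    element is a matter of describing more pairs (see [adjoin_rel]).  Its kernel
    condition [phom0_eq0] is what makes the relation single-valued. *)
Record partial_hom (A B : fieldType) (R : A -> B -> Prop) : Prop := PartialHom {
  phom1 : R 1 1;
  phomN : forall a b, R a b -> R (- a) (- b);
  phomD : forall a b a' b', R a b -> R a' b' -> R (a + a') (b + b');
  phomM : forall a b a' b', R a b -> R a' b' -> R (a * a') (b * b');
  phom0_eq0 : forall b, R 0 b -> b = 0
}.

Definition poly_rel (A B : fieldType) (R : A -> B -> Prop)
    (p : {poly A}) (q : {poly B}) : Prop :=
  forall i, R p`_i q`_i.

Section PartialHom.

Variables (A B : fieldType) (R : A -> B -> Prop).
Hypothesis homR : partial_hom R.

Lemma phom0 : R 0 0.
Proof.
rewrite -(subrr 1) -(subrr (1 : B)).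
by apply: (phomD homR); [|apply: (phomN homR)]; apply: (phom1 homR).
Qed.

Lemma phomB a b a' b' : R a b -> R a' b' -> R (a - a') (b - b').
Proof. by move=> ab ab'; apply: (phomD homR) => //; apply: (phomN homR). Qed.

Lemma phom_fun a b b' : R a b -> R a b' -> b = b'.
Proof.
by move=> ab ab'; apply/eqP; rewrite -subr_eq0; apply/eqP/(phom0_eq0 homR);
  rewrite -(subrr a); apply: phomB.
Qed.

Lemma phom_neq0 a b : R a b -> b != 0 -> a != 0.
Proof.
move=> ab; apply: contraNneq => a0; apply/eqP/(phom0_eq0 homR).
by rewrite -a0.
Qed.

Lemma phomV a b : R a b -> (exists c, R a^-1 c) \/ R a^-1^-1 0 -> b != 0 ->
  R a^-1 b^-1.
Proof.
move=> ab val_a nz_b; have nz_a := phom_neq0 ab nz_b.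
case: val_a => [[c ac]|]; last first.
  by rewrite invrK => a0; rewrite (phom_fun ab a0) eqxx in nz_b.
suff -> : b^-1 = c by [].
apply: (mulfI nz_b); rewrite divff //.
apply: phom_fun (phomM homR ab ac) => //.
by rewrite divff //; apply: (phom1 homR).
Qed.

Lemma phom_sum (I : Type) (r : seq I) (P : pred I) (f : I -> A) (g : I -> B) :
  (forall i, P i -> R (f i) (g i)) ->
  R (\sum_(i <- r | P i) f i) (\sum_(i <- r | P i) g i).
Proof.
by move=> fg; apply: (big_rec2 R) => [|i x y Pi xy];
  [apply: phom0 | apply: (phomD homR); auto].
Qed.

Lemma phomX n a b : R a b -> R (a ^+ n) (b ^+ n).
Proof.
move=> ab; elim: n => [|n IHn]; first by rewrite !expr0; apply: (phom1 homR).
by rewrite !exprS; apply: (phomM homR).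
Qed.

Local Notation prel := (poly_rel R).
Implicit Types (p : {poly A}) (q : {poly B}).

Lemma prelC a b : R a b -> prel a%:P b%:P.
Proof. by move=> ab i; rewrite !coefC; case: ifP => // _; apply: phom0. Qed.

Lemma prelX : prel 'X 'X.
Proof.
by move=> i; rewrite !coefX; case: (i == 1%N); [apply: (phom1 homR) | apply: phom0].
Qed.

Lemma prelD p q p' q' : prel p q -> prel p' q' -> prel (p + p') (q + q').
Proof. by move=> pq pq' i; rewrite !coefD; apply: (phomD homR). Qed.

Lemma prelN p q : prel p q -> prel (- p) (- q).
Proof. by move=> pq i; rewrite !coefN; apply: (phomN homR). Qed.

Lemma prelB p q p' q' : prel p q -> prel p' q' -> prel (p - p') (q - q').
Proof. by move=> pq pq'; apply: prelD => //; apply: prelN. Qed.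

Lemma prelM p q p' q' : prel p q -> prel p' q' -> prel (p * p') (q * q').
Proof.
by move=> pq pq' i; rewrite !coefM; apply: phom_sum => j _; apply: (phomM homR).
Qed.

Lemma prelZ a b p q : R a b -> prel p q -> prel (a *: p) (b *: q).
Proof. by move=> ab pq i; rewrite !coefZ; apply: (phomM homR). Qed.

Lemma prelXsubC a b : R a b -> prel ('X - a%:P) ('X - b%:P).
Proof. by move=> ab; apply: prelB; [apply: prelX | apply: prelC]. Qed.

Lemma prel_fun p q q' : prel p q -> prel p q' -> q = q'.
Proof. by move=> pq pq'; apply/polyP => i; apply: phom_fun (pq i) (pq' i). Qed.

Lemma prel_horner p q a b : prel p q -> R a b -> R p.[a] q.[b].
Proof.
move=> pq ab; set n := maxn (size p) (size q).
rewrite (@horner_coef_wide _ n p) ?leq_maxl //.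
rewrite (@horner_coef_wide _ n q) ?leq_maxr //.
by apply: phom_sum => i _; apply: (phomM homR) => //; apply: phomX.
Qed.

Lemma prel_size p q : prel p q -> (size q <= size p)%N.
Proof.
move=> pq; apply/leq_sizeP => i le_i; apply: (phom0_eq0 homR).
by rewrite -(nth_default 0 le_i).
Qed.

Lemma prel_monic p q : prel p q -> p \is monic ->
  q \is monic /\ size q = size p.
Proof.
move=> pq mon_p.
have q1 : q`_(size p).-1 = 1.
  apply: (phom_fun (pq _)); rewrite -lead_coefE (monicP mon_p).
  exact: (phom1 homR).
have sz_q : size q = size p.
  apply/eqP; rewrite eqn_leq prel_size //.
  have p_gt0 : (0 < size p)%N by rewrite size_poly_gt0 monic_neq0.
  rewrite -[X in (X <= _)%N](prednK p_gt0) ltnNge; apply/negP => le_q.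
  by move/eqP: q1; rewrite nth_default // eq_sym oner_eq0.
by split => //; rewrite monicE lead_coefE sz_q q1.
Qed.

Lemma prel_exists p : (forall i, exists b, R p`_i b) -> exists q, prel p q.
Proof.
elim/poly_ind: p => [|p c IHp] Rp.
  by exists 0 => i; rewrite !coef0; apply: phom0.
have [|q pq] := IHp.
  by move=> i; have := Rp i.+1; rewrite coefD coefMX coefC addr0.
have [b] := Rp 0%N; rewrite coefD coefMX coefC add0r => cb.
exists (q * 'X + b%:P).
by apply: prelD; [apply: prelM => //; apply: prelX | apply: prelC].
Qed.

End PartialHom.

(** By [place_val] the domain of [R] is a valuation ring of [K], and the
    elements outside of it are those whose inverse reduces to [0]. *)
Record place (F k : fieldType) (L : fieldExtType F) (L' : fieldExtType k)
    (K : {subfield L}) (K' : {subfield L'}) (R : L -> L' -> Prop) : Prop :=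
  Place {
  place_hom : partial_hom R;
  place_dom : forall a b, R a b -> a \in K;
  place_cod : forall a b, R a b -> b \in K';
  place_val : forall a, a \in K -> (exists b, R a b) \/ R a^-1 0
}.

Section Place.

Variables (F k : fieldType) (L : fieldExtType F) (L' : fieldExtType k).
Variables (K : {subfield L}) (K' : {subfield L'}) (R : L -> L' -> Prop).
Hypothesis plR : place K K' R.

Let homR : partial_hom R := place_hom plR.
Local Notation prel := (poly_rel R).

Lemma placeV a b : R a b -> b != 0 -> R a^-1 b^-1.
Proof.
by move=> ab; apply: (phomV homR ab); apply: (place_val plR);
  rewrite rpredV (place_dom plR ab).
Qed.

Lemma prel_over (p : {poly L}) (q : {poly L'}) : prel p q ->
  p \is a polyOver K /\ q \is a polyOver K'.
Proof.
move=> pq; split; apply/polyOverP => i.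
  exact: (place_dom plR (pq i)).
exact: (place_cod plR (pq i)).
Qed.

(** Dividing by an element of least valuation makes a family integral.  As the
    place is only given by a relation, that element is found by pairwise
    comparison. *)
Lemma place_min (s : seq L) : {subset s <= K} -> has (predC1 0) s ->
  exists2 c, (c \in s) && (c != 0) & forall a, a \in s -> exists b, R (a / c) b.
Proof.
elim: s => // x s IHs sK /=.
have Kx : x \in K by apply: sK; rewrite mem_head.
have sK' : {subset s <= K} by move=> a s_a; apply: sK; rewrite inE s_a orbT.
have R0 : exists b, R 0 b by exists 0; apply: (phom0 homR).
have R1 : exists b, R 1 b by exists 1; apply: (phom1 homR).
have [s_nz _|s_z] := boolP (has (predC1 0) s); last first.
  rewrite orbF => nz_x; exists x; first by rewrite mem_head.
  move=> a; rewrite inE => /predU1P[->|s_a]; first by rewrite divff.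
  by have := hasPn s_z _ s_a; rewrite /= negbK => /eqP->; rewrite mul0r.
have [c /andP[s_c nz_c] Rc] := IHs sK' s_nz.
have [Rx|Rcx] := place_val plR (rpred_div Kx (sK' c s_c)).
  exists c; first by rewrite inE s_c orbT nz_c.
  by move=> a; rewrite inE => /predU1P[->|/Rc].
have [x0|nz_x] := eqVneq x 0.
  exists c; first by rewrite inE s_c orbT nz_c.
  by move=> a; rewrite inE => /predU1P[->|/Rc] //; rewrite x0 mul0r.
exists x; first by rewrite mem_head.
move=> a; rewrite inE => /predU1P[->|/Rc[b Rb]]; first by rewrite divff.
exists (b * 0); have -> : a / x = a / c * (x / c)^-1.
  by rewrite invf_div mulrA divfK.
exact: (phomM homR).
Qed.

(** The counterpart, over a valuation ring, of extracting the content of a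
    polynomial: the primitive part is the one with a nonzero reduction. *)
Lemma place_primitive (p : {poly L}) : p \is a polyOver K -> p != 0 ->
  exists c p1 q1, [/\ c \in K, c != 0, p = c *: p1, prel p1 q1 & q1 != 0].
Proof.
move=> Kp nz_p; have [||c /andP[pc nz_c] Rc] := @place_min p.
- by move=> a /(nthP 0)[i _ <-]; apply: (polyOverP Kp).
- apply/hasP; exists (lead_coef p); last by rewrite /= lead_coef_eq0.
  by rewrite lead_coefE mem_nth // prednK // size_poly_gt0.
have [i lt_i Dc] := nthP 0 pc.
have [q1 pq1] : exists q1, prel (c^-1 *: p) q1.
  apply: prel_exists => // j; rewrite coefZ mulrC.
  have [lt_j|le_j] := ltnP j (size p); first exact: Rc (mem_nth _ _).
  by exists 0; rewrite nth_default // mul0r; apply: (phom0 homR).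
exists c, (c^-1 *: p), q1; split => //.
- by rewrite -Dc; apply: (polyOverP Kp).
- by rewrite scalerA divff // scale1r.
apply/eqP => q0; have := pq1 i; rewrite q0 coef0 coefZ Dc mulVf //.
by move/(phom_fun homR (phom1 homR))/eqP; rewrite oner_eq0.
Qed.

(** The reductions of [q] and of the primitive part of [p] are nonzero, hence so
    is some coefficient of their product.  Comparing this coefficient with the one
    of [p * q], which is finite, shows that the content of [p] is finite. *)
Lemma gauss_factor (p q : {poly L}) (q' r : {poly L'}) :
  p \is a polyOver K -> prel q q' -> q' != 0 ->
  prel (p * q) r -> exists p', prel p p'.
Proof.
move=> Kp qq' nz_q' pqr; have [->|nz_p] := eqVneq p 0.
  by exists 0 => i; rewrite !coef0; apply: (phom0 homR).
have [c [p1 [q1 [Kc nz_c Dp pq1 nz_q1]]]] := place_primitive Kp nz_p.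
have nz1 : q1 * q' != 0 by rewrite mulf_neq0.
have nzu : (q1 * q')`_(size (q1 * q')).-1 != 0.
  by rewrite -lead_coefE lead_coef_eq0.
set i := _.-1 in nzu; have Ru := prelM homR pq1 qq' i.
have Ri := pqr i; rewrite Dp -scalerAl coefZ in Ri.
have := phomM homR Ri (placeV Ru nzu).
rewrite mulfK ?(phom_neq0 homR Ru nzu) // => Rc.
by eexists; rewrite Dp; apply: (prelZ homR Rc pq1).
Qed.

(** Neither factor has a coefficient of negative valuation: if [c] is the content
    of [g], then [g / c] is primitive, so [c h] is integral by [gauss_factor], and
    [c] is its leading coefficient. *)
Lemma gauss_monic (f g h : {poly L}) (f' : {poly L'}) : prel f f' -> f = g * h ->
  g \is monic -> h \is monic -> g \is a polyOver K -> h \is a polyOver K ->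
  exists g' h', [/\ prel g g', prel h h' & f' = g' * h'].
Proof.
move=> ff' Df mon_g mon_h Kg Kh.
have [c [g1 [q1 [Kc nz_c Dg gq1 nz_q1]]]] :=
  place_primitive Kg (monic_neq0 mon_g).
have [||h1 hh1] := @gauss_factor (c *: h) g1 q1 f' _ gq1 nz_q1.
- by apply/polyOverP => i; rewrite coefZ rpredM ?(polyOverP Kh).
- have -> : (c *: h) * g1 = f by rewrite Df Dg -!scalerAl mulrC.
  exact: ff'.
have Rc : R c h1`_(size h).-1.
  have := hh1 (size h).-1; rewrite coefZ -lead_coefE (monicP mon_h).
  by rewrite mulr1.
have gg' : prel g (h1`_(size h).-1 *: q1) by rewrite Dg; apply: prelZ.
have [h' hh'] : exists h', prel h h'.
  apply: (@gauss_factor h g (h1`_(size h).-1 *: q1) f') => //.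
    by have [/monic_neq0] := prel_monic homR gg' mon_g.
  by rewrite mulrC -Df.
exists (h1`_(size h).-1 *: q1), h'; split => //.
by apply: (prel_fun homR ff'); rewrite Df; apply: prelM.
Qed.

End Place.

Lemma prel_divXsubC (F k : fieldType) (L : fieldExtType F)
    (L' : fieldExtType k) (K : {subfield L}) (K' : {subfield L'})
    (R : L -> L' -> Prop) (f : {poly L}) (f' : {poly L'}) (x : L) (y : L') :
  place K K' R -> R x y -> f \is monic ->
  poly_rel R (('X - x%:P) * f) (('X - y%:P) * f') -> poly_rel R f f'.
Proof.
move=> plR Rxy mon_f ff'; have homR := place_hom plR.
have Kx : 'X - x%:P \is a polyOver K.
  by rewrite polyOverXsubC (place_dom plR Rxy).
have Kf : f \is a polyOver K.
  have -> : f = (('X - x%:P) * f) %/ ('X - x%:P).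
    by rewrite mulrC mulpK // polyXsubC_eq0.
  by apply: divp_polyOver => //; case: (prel_over plR ff').
have [g' [h1 [gg' hh1 /esym Df']]] :=
  gauss_monic plR ff' erefl (monicXsubC x) mon_f Kx Kf.
move: Df'; rewrite (prel_fun homR gg' (prelXsubC homR Rxy)).
by move/mulfI => <-; rewrite ?polyXsubC_eq0.
Qed.

(** * Extension of a place to a simple extension *)

(** The extension of [R] that sends [x] to [y] has to be given by
    [p(x) |-> q(y)], where [q] is the reduction of [p]. *)
Definition adjoin_rel (A B : fieldType) (R : A -> B -> Prop) (x : A) (y : B) :
    A -> B -> Prop :=
  fun a b => exists p q, [/\ poly_rel R p q, a = p.[x] & b = q.[y]].

Section Adjoin.

Variables (F k : fieldType) (L : fieldExtType F) (L' : fieldExtType k).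
Variables (K : {subfield L}) (K' : {subfield L'}) (R : L -> L' -> Prop).
Hypothesis plR : place K K' R.
Let homR : partial_hom R := place_hom plR.
Local Notation prel := (poly_rel R).

Variables (x : L) (y : L') (m' : {poly L'}).
Hypotheses (mm' : prel (minPoly K x) m') (m'y : root m' y).
Local Notation R' := (adjoin_rel R x y).

Lemma adjoin_relS a b : R a b -> R' a b.
Proof. by exists a%:P, b%:P; rewrite !hornerC; split => //; apply: prelC. Qed.

Lemma adjoin_rel_gen : R' x y.
Proof. by exists 'X, 'X; rewrite !hornerX; split => //; apply: prelX. Qed.

Lemma prel_adjoin (p : {poly L}) (q : {poly L'}) : prel p q -> poly_rel R' p q.
Proof. by move=> pq i; apply: adjoin_relS. Qed.

(** The extension is well defined because, by the Gauss lemma, an integral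
    polynomial that vanishes at [x] is an integral multiple of the minimal
    polynomial of [x], whose reduction vanishes at [y]. *)
Lemma adjoin_rel_hom : partial_hom R'.
Proof.
split.
- exact/adjoin_relS/(phom1 homR).
- move=> _ _ [p [q [pq -> ->]]]; exists (- p), (- q).
  by rewrite !hornerN; split => //; apply: prelN.
- move=> _ _ _ _ [p [q [pq -> ->]]] [p1 [q1 [pq1 -> ->]]].
  by exists (p + p1), (q + q1); rewrite !hornerD; split => //; apply: prelD.
- move=> _ _ _ _ [p [q [pq -> ->]]] [p1 [q1 [pq1 -> ->]]].
  by exists (p * p1), (q * q1); rewrite !hornerM; split => //; apply: prelM.
move=> b [p [q [pq px0 ->]]].
have [Kp _] := prel_over plR pq.
have mp : minPoly K x %| p by apply: minPoly_dvdp => //; rewrite /root -px0.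
have [mon_m' _] := prel_monic homR mm' (monic_minPoly K x).
have Dp := divpK mp.
have [||h hh] := @gauss_factor _ _ _ _ _ _ _ plR (p %/ minPoly K x)
  (minPoly K x) m' q _ mm' (monic_neq0 mon_m').
- by rewrite divp_polyOver ?minPolyOver.
- by rewrite Dp.
have -> : q = h * m'.
  by apply: (prel_fun homR pq); rewrite -Dp; apply: prelM.
by rewrite hornerM (rootP m'y) mulr0.
Qed.

Lemma adjoin_rel_dom a b : R' a b -> a \in <<K; x>>%VS.
Proof.
by case=> p [q [pq -> _]]; apply: mempx_Fadjoin; case: (prel_over plR pq).
Qed.

Lemma adjoin_rel_cod a b : R' a b -> b \in <<K'; y>>%VS.
Proof.
by case=> p [q [pq _ ->]]; apply: mempx_Fadjoin; case: (prel_over plR pq).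
Qed.

(** When [R] is everywhere defined, that is, a field embedding, [y] can be any
    root of the image of the minimal polynomial of [x]. *)
Lemma adjoin_place_total : (forall a, a \in K -> exists b, R a b) ->
  place <<K; x>>%AS <<K'; y>>%AS R'.
Proof.
move=> totR; split; [exact: adjoin_rel_hom | exact: adjoin_rel_dom
  | exact: adjoin_rel_cod |].
move=> a /Fadjoin_polyP[p Kp ->]; left.
have [|q pq] := prel_exists homR (p := p).
  by move=> i; apply: totR; apply: (polyOverP Kp).
by exists q.[y], p, q.
Qed.

(** If the reduced minimal polynomial stays irreducible, the powers of [x] below
    the degree behave like an orthogonal basis for the valuation: a polynomial of
    small degree with nonzero reduction takes at [x] a value with nonzero
    reduction.  Hence every element of the extension is an element of [K] times a
    unit, and the valuation property is inherited from [K]. *)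
Lemma adjoin_place_minPoly : m' = minPoly K' y ->
  place <<K; x>>%AS <<K'; y>>%AS R'.
Proof.
move=> Dm'; have homR' := adjoin_rel_hom.
split; [exact: homR' | exact: adjoin_rel_dom | exact: adjoin_rel_cod |].
have size_m : adjoin_degree K x = adjoin_degree K' y.
  apply: succn_inj; rewrite -!size_minPoly -Dm'.
  by have [_ ->] := prel_monic homR mm' (monic_minPoly K x).
have prim a : a \in <<K; x>>%VS -> a != 0 -> exists c a1 b1,
    [/\ c \in K, c != 0, a = c * a1, R' a1 b1 & b1 != 0].
  move=> Ka nz_a; have := Fadjoin_poly_eq Ka.
  set p := Fadjoin_poly K x a => Da.
  have nz_p : p != 0 by apply: contraNneq nz_a => p0; rewrite -Da p0 horner0.
  have [c [p1 [q1 [Kc nz_c Dp pq1 nz_q1]]]] :=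
    place_primitive plR (Fadjoin_polyOver K x a) nz_p.
  exists c, p1.[x], q1.[y]; split => //; first by rewrite -Da /p Dp hornerZ.
    by exists p1, q1.
  have [_ Kq1] := prel_over plR pq1.
  rewrite -[_ == 0]/(root q1 y) (root_small_adjoin_poly Kq1) //.
  rewrite -size_m; apply: leq_trans (size_Fadjoin_poly K x a).
  by rewrite Dp size_scale // (prel_size homR pq1).
(* [a] and its inverse are [c] and [d] times units, so [c * d] is a unit of [K];
   whether [a] or its inverse is finite is then decided by [c]. *)
move=> a Ka; have [->|nz_a] := eqVneq a 0.
  by left; exists 0; apply: phom0.
have [c [a1 [b1 [Kc nz_c Da Rab1 nz_b1]]]] := prim a Ka nz_a.
have [||d [a2 [b2 [Kd nz_d Da' Rab2 nz_b2]]]] := prim a^-1.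
- exact: rpredVr.
- by rewrite invr_eq0.
have Rab := phomM homR' Rab1 Rab2; have nz_b := mulf_neq0 nz_b1 nz_b2.
have cd1 : (c * d) * (a1 * a2) = 1 by rewrite mulrACA -Da -Da' divff.
have nz_cd : c * d != 0 by rewrite mulf_neq0.
have [u Ru] : exists u, R (c * d) u.
  have [//|/adjoin_relS] := place_val plR (rpredM Kc Kd).
  have -> : (c * d)^-1 = a1 * a2.
    by apply: (mulfI nz_cd); rewrite cd1 divff.
  by move/(phom_fun homR' Rab) => b0; rewrite b0 eqxx in nz_b.
have [[v Rv]|Rv] := place_val plR Kc; [left | right].
  by exists (v * b1); rewrite Da; apply: (phomM homR') => //; apply: adjoin_relS.
rewrite Da' -(mulKf nz_c d) -(mul0r (u * b2)) -!mulrA.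
apply: (phomM homR'); first exact: adjoin_relS.
by rewrite mulrA; apply: (phomM homR') => //; apply: adjoin_relS.
Qed.

End Adjoin.

(** * Towers of maximal degree and their specializations *)

(** For the roots of a polynomial over [K], these degrees are the largest
    possible, and their product is the order of the symmetric group. *)
Fixpoint full_tower (F : fieldType) (L : fieldExtType F) (K : {subfield L})
    (xs : seq L) : bool :=
  if xs is x :: xs' then
    (adjoin_degree K x == size xs) && full_tower <<K; x>>%AS xs'
  else true.

Lemma dvdp_monic_size (F : fieldType) (p q : {poly F}) :
  p \is monic -> q \is monic -> p %| q -> size p = size q -> p = q.
Proof.
move=> mon_p mon_q pq sz; apply/eqP; rewrite -eqp_monic //.
by rewrite -dvdp_size_eqp // sz.
Qed.

(** The reduction [m'] of the minimal polynomial of the first root [x] divides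
    the reduction of the whole product, which is the minimal polynomial of [y].
    So both have full degree, the place extends with [x] sent to [y], and the
    linear factors at [x] and [y] can be removed.  The root [x] is simple
    because [y] is. *)
Lemma full_specialize (F k : fieldType) (L : fieldExtType F)
    (L' : fieldExtType k) (K : {subfield L}) (K' : {subfield L'})
    (R : L -> L' -> Prop) (xs : seq L) (ys : seq L') :
  place K K' R ->
  poly_rel R (\prod_(x <- xs) ('X - x%:P)) (\prod_(y <- ys) ('X - y%:P)) ->
  uniq ys -> full_tower K' ys -> uniq xs && full_tower K xs.
Proof.
elim: ys xs K K' R => [|y ys IHys] xs K K' R plR ff' uys fys.
  have [_] := prel_monic (place_hom plR) ff' (monic_prod_XsubC _ _ _).
  by rewrite !size_prod_XsubC; case: xs {ff'}.
have homR := place_hom plR.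
have [_] := prel_monic homR ff' (monic_prod_XsubC _ _ _).
rewrite !size_prod_XsubC; case: xs ff' => // x xs ff' [sz_xs].
move: uys fys => /= /andP[ys'y uys] /andP[/eqP deg_y fys].
set f := \prod_(z <- x :: xs) _ in ff'.
set f' := \prod_(z <- y :: ys) _ in ff'.
have [Kf Kf'] := prel_over plR ff'.
have mon_f : f \is monic by apply: monic_prod_XsubC.
have mon_f' : f' \is monic by apply: monic_prod_XsubC.
have Df' : minPoly K' y = f'.
  apply: dvdp_monic_size; rewrite ?monic_minPoly //.
    by apply: minPoly_dvdp; rewrite // root_prod_XsubC mem_head.
  by rewrite size_minPoly deg_y size_prod_XsubC.
have mf : minPoly K x %| f.
  by apply: minPoly_dvdp; rewrite // root_prod_XsubC mem_head.
have Df : f = minPoly K x * (f %/ minPoly K x) by rewrite mulrC divpK.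
have mon_h : f %/ minPoly K x \is monic.
  by rewrite -(monicMl _ (monic_minPoly K x)) -Df.
have [m' [h' [mm' hh' Dm']]] := gauss_monic plR ff' Df (monic_minPoly K x)
  mon_h (minPolyOver K x) (divp_polyOver Kf (minPolyOver K x)).
have [mon_m' sz_m'] := prel_monic homR mm' (monic_minPoly K x).
have [_ Km'] := prel_over plR mm'.
have {}Dm' : m' = f'.
  have := @minPoly_irr _ _ K' y m' Km'; rewrite Df' Dm' dvdp_mulr //.
  move=> /(_ isT)/orP[|].
    by rewrite eqp_monic -?Dm' // => /eqP.
  by rewrite -size_poly_eq1 sz_m' size_minPoly eqSS.
have Rx : place <<K; x>>%AS <<K'; y>>%AS (adjoin_rel R x y).
  apply: (adjoin_place_minPoly plR mm'); last by rewrite Df'.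
  by rewrite Dm' root_prod_XsubC mem_head.
have homR' := place_hom Rx.
have ff1 := prel_adjoin plR x y ff'.
have hh1 : poly_rel (adjoin_rel R x y) (\prod_(z <- xs) ('X - z%:P))
                                       (\prod_(z <- ys) ('X - z%:P)).
  apply: (prel_divXsubC Rx (adjoin_rel_gen plR x y) (monic_prod_XsubC _ _ _)).
  by move: ff1; rewrite /f /f' !big_cons.
have /andP[-> ->] := IHys xs _ _ _ Rx hh1 uys fys.
rewrite !andbT; apply/andP; split; last first.
  rewrite -eqSS -size_minPoly -sz_m' Dm' size_prod_XsubC /= -sz_xs.
  by rewrite eqxx.
apply: contra ys'y => xs_x; rewrite -root_prod_XsubC; apply/rootP.
have := prel_horner homR' hh1 (adjoin_rel_gen plR x y).
rewrite (rootP (_ : root _ x)); last by rewrite root_prod_XsubC.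
exact: (phom0_eq0 homR').
Qed.

Definition valuative (A B : fieldType) (R : A -> B -> Prop) : Prop :=
  forall a, (exists b, R a b) \/ R a^-1 0.

(** A [place] lives on subfields of extensions, so a relation between the base
    fields is moved to their images, the scalars. *)
Definition base_rel (F k : fieldType) (R : F -> k -> Prop)
    (L : fieldExtType F) (L' : fieldExtType k) : L -> L' -> Prop :=
  fun a b => exists c d, [/\ R c d, a = c%:A & b = d%:A].

Section Base.

Variables (F k : fieldType) (R : F -> k -> Prop).
Variables (L : fieldExtType F) (L' : fieldExtType k).
Hypothesis homR : partial_hom R.

Local Notation R1 := (@base_rel F k R L L').

Lemma base_hom : partial_hom R1.
Proof.
split.
- by exists 1, 1; rewrite !scale1r; split => //; apply: (phom1 homR).
- move=> _ _ [c [d [Rcd -> ->]]]; exists (- c), (- d).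
  by rewrite !scaleNr; split => //; apply: (phomN homR).
- move=> _ _ _ _ [c [d [Rcd -> ->]]] [c' [d' [Rcd' -> ->]]].
  exists (c + c'), (d + d').
  by rewrite !scalerDl; split => //; apply: (phomD homR).
- move=> _ _ _ _ [c [d [Rcd -> ->]]] [c' [d' [Rcd' -> ->]]].
  exists (c * c'), (d * d').
  by rewrite -!scalerAl !mul1r !scalerA; split => //; apply: (phomM homR).
move=> _ [c [d [Rcd /esym/eqP c0 ->]]].
rewrite scaler_eq0 oner_eq0 orbF in c0; move/eqP: c0 => c0.
by rewrite (phom0_eq0 homR (b := d)) ?scale0r // -c0.
Qed.

Lemma base_poly_rel f f' : poly_rel R f f' ->
  poly_rel R1 (map_poly (in_alg L) f) (map_poly (in_alg L') f').
Proof. by move=> ff' i; rewrite !coef_map; exists f`_i, f'`_i. Qed.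

Lemma base_place : valuative R -> place 1%AS 1%AS R1.
Proof.
move=> valR; split; first exact: base_hom.
- by move=> _ _ [c [d [_ -> _]]]; rewrite rpredZ ?mem1v.
- by move=> _ _ [c [d [_ _ ->]]]; rewrite rpredZ ?mem1v.
move=> a /vlineP[c ->]; have [[d Rcd]|Rc] := valR c; [left | right].
  by exists d%:A, c, d.
by exists c^-1, 0; rewrite scale0r; split; rewrite // -[_ *: _]/(in_alg L c) -fmorphV.
Qed.

End Base.

(** Quantifying over all extensions that split [f] makes the property directly
    applicable to a given splitting field; it is not vacuous, by
    [splitting_extension]. *)
Definition full_galois (F : fieldType) (f : {poly F}) : Prop :=
  forall (L : fieldExtType F) (xs : seq L),
    map_poly (in_alg L) f = \prod_(x <- xs) ('X - x%:P) ->
  uniq xs && full_tower 1%AS xs.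

(** Irreducibility over an arbitrary field is not decidable, whence the appeal
    to the excluded middle. *)
Lemma irreducible_factor (F : fieldType) (p : {poly F}) : (1 < size p)%N ->
  exists2 r : {poly F}, r %| p & irreducible_poly r.
Proof.
have [n] := ubnP (size p); elim: n => // n IHn in p *; rewrite ltnS => le_p p_gt1.
have [irr_p|red_p] := classic (irreducible_poly p); first by exists p.
have [[q [q1 qp nqp]]|no_q] :=
  classic (exists q : {poly F}, [/\ size q != 1%N, q %| p & ~~ (q %= p)]).
  have nz_p : p != 0 by rewrite -size_poly_gt0 ltnW.
  have [||r rq irr_r] := IHn q.
  - apply: leq_trans le_p; rewrite ltn_neqAle (dvdp_leq nz_p qp) andbT.
    by rewrite dvdp_size_eqp.
  - by rewrite ltn_neqAle eq_sym q1 size_poly_gt0 (dvdpN0 qp).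
  by exists r => //; apply: dvdp_trans qp.
case: red_p; split => // q q1 qp; apply/negPn/negP => nqp.
by apply: no_q; exists q.
Qed.

Lemma splitting_extension (F : fieldType) (p : {poly F}) : p \is monic ->
  exists (L : fieldExtType F) (xs : seq L),
    map_poly (in_alg L) p = \prod_(x <- xs) ('X - x%:P).
Proof.
have [n] := ubnP (size p); elim: n => // n IHn in F p *; rewrite ltnS => le_p mon_p.
have [Cp|C'p] := leqP (size p) 1.
  exists F^o, [::]; rewrite big_nil (_ : p = 1) ?rmorph1 //.
  apply/eqP; rewrite -eqp_monic ?rpred1 // -size_poly_eq1 eqn_leq Cp.
  by rewrite size_poly_gt0 monic_neq0.
have [r r_dv_p irr_r] := irreducible_factor C'p.
have [K _ [x rx0 defK]] := irredp_FAdjoin irr_r.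
have /factor_theorem[q Dp] : root (map_poly (in_alg K) p) x.
  by rewrite -(divpK r_dv_p) rmorphM rootM rx0 orbT.
have Dszp : size p = size (q * ('X - x%:P)) by rewrite -Dp size_map_poly.
have mon_q : q \is monic.
  by rewrite -(monicMr _ (monicXsubC x)) -Dp map_monic.
have [|L [zs Dq]] := IHn K q _ mon_q.
  by move: le_p; rewrite Dszp size_Mmonic ?monicXsubC ?monic_neq0 ?size_XsubC ?addn2.
exists (baseFieldType L), (x%:A :: zs); rewrite big_cons.
rewrite (eq_map_poly (fun a : F => baseField_scaleE a (1 : L))).
have -> : map_poly (fun a : F => a%:A *: 1 : L) p
   = map_poly (in_alg L) (map_poly (in_alg K) p).
  by rewrite -map_poly_comp.
by rewrite Dp mulrC rmorphM /= map_polyXsubC -Dq.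
Qed.

(** Fullness lifts from the reduction at a place: it suffices to pick an
    extension where the reduction splits, and to compare the roots there with the
    roots of [f]. *)
Lemma full_galois_specialize (F k : fieldType) (R : F -> k -> Prop)
    (f : {poly F}) (f' : {poly k}) :
  partial_hom R -> valuative R -> f \is monic -> poly_rel R f f' ->
  full_galois f' -> full_galois f.
Proof.
move=> homR valR mon_f ff' full_f' L xs Df.
have [mon_f' _] := prel_monic homR ff' mon_f.
have [L' [ys Df']] := splitting_extension mon_f'.
have /andP[uys fys] := full_f' L' ys Df'.
apply: (full_specialize (base_place L L' homR valR) _ uys fys).
by rewrite -Df -Df'; apply: base_poly_rel.
Qed.

(** * From degrees to the symmetric group *)

(** Since [x] has full degree, [y] is a conjugate of it; after moving [y] back to
    [x], the remaining roots are rearranged over the field generated by [x].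
    The list [ys] is any list with the same product, so any permutation of [xs]. *)
Lemma full_tower_transitive (F : fieldType) (L : splittingFieldType F)
    (K : {subfield L}) (xs ys : seq L) :
  \prod_(x <- xs) ('X - x%:P) \is a polyOver K ->
  \prod_(x <- xs) ('X - x%:P) = \prod_(y <- ys) ('X - y%:P) -> full_tower K xs ->
  exists2 g, g \in 'Gal({:L} / K)%g & map (g : gal_of {:L}) xs = ys.
Proof.
elim: xs ys K => [|x xs IHxs] ys K Kf.
  move=> /(congr1 (size \o @polyseq L)) /=; rewrite !size_prod_XsubC.
  by case: ys => // _ _; exists 1%g; rewrite ?group1.
move=> xy; have := congr1 (size \o @polyseq L) xy; rewrite /= !size_prod_XsubC.
case: ys xy => // y ys xy _ /andP[/eqP deg_x full_xs].
set f := \prod_(z <- x :: xs) _ in Kf.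
have Df : minPoly K x = f.
  apply: dvdp_monic_size; rewrite ?monic_minPoly ?monic_prod_XsubC //.
    by apply: minPoly_dvdp; rewrite // root_prod_XsubC mem_head.
  by rewrite size_minPoly deg_x size_prod_XsubC.
have Df1 : f = ('X - x%:P) * \prod_(z <- xs) ('X - z%:P) by rewrite /f big_cons.
have fy : root (minPoly K x) y.
  by rewrite Df /f xy root_prod_XsubC mem_head.
have [h hK Dy] := normalField_root_minPoly (subvf K) (normalFieldf K) (memvf x) fy.
have hV z : (h^-1)%g (h z) = z.
  by rewrite -galM ?memvf // mulgV gal_id.
have Vh z : h ((h^-1)%g z) = z.
  by rewrite -galM ?memvf // mulVg gal_id.
have Dx : (h^-1)%g y = x by rewrite -Dy hV.
have [|||g gK Dg] := IHxs (map (h^-1)%g ys) <<K; x>>%AS.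
- have -> : \prod_(z <- xs) ('X - z%:P) = f %/ ('X - x%:P).
    by rewrite Df1 mulrC mulpK // polyXsubC_eq0.
  apply: divp_polyOver; first exact: (polyOverSv (subv_adjoin K x)).
  by rewrite polyOverXsubC memv_adjoin.
- have Df2 : f = \prod_(z <- map (h^-1)%g (y :: ys)) ('X - z%:P).
    have {1}-> : f = map_poly (h^-1)%g f.
      apply/polyP => i; rewrite coef_map /= (fixed_gal (subvf K)) ?groupV //.
      exact: (polyOverP Kf).
    rewrite /f xy rmorph_prod big_map /=.
    by apply: eq_bigr => z _; rewrite map_polyXsubC.
  move: Df2; rewrite Df1 /= big_cons Dx.
  by apply: mulfI; rewrite polyXsubC_eq0.
- exact: full_xs.
exists (g * h)%g.
  by rewrite groupM // (subsetP (galS _ (subv_adjoin K x))).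
congr (_ :: _).
  by rewrite galM ?memvf // (fixed_gal _ gK) ?subvf ?memv_adjoin.
rewrite (eq_map (g := h \o g)); last by move=> z /=; rewrite galM ?memvf.
by rewrite map_comp Dg -map_comp map_id_in // => z _; apply: Vh.
Qed.

Lemma full_tower_gal_perms (F : fieldType) (L : splittingFieldType F) (n : nat)
    (rs : n.-tuple L) :
  \prod_(x <- rs) ('X - x%:P) \is a polyOver 1%VS ->
  full_tower 1%AS rs -> gal_perms rs = [set: 'S_n].
Proof.
move=> F_rs full_rs; apply/setP => s; rewrite !inE.
pose ys := [tuple tnth rs (s i) | i < n].
have [|g gK Dg] := @full_tower_transitive _ L 1%AS rs ys F_rs _ full_rs.
  rewrite !big_tuple (reindex_inj (@perm_inj _ s)) /=.
  by apply: eq_bigr => i _; rewrite tnth_mktuple.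
apply/exists_inP; exists g => //; apply/forallP => i; apply/eqP.
rewrite -(tnth_mktuple (fun i => tnth rs (s i))) -/ys.
by rewrite !(tnth_nth 0) -[RHS]/(nth 0 ys i) -Dg (nth_map 0) ?size_tuple.
Qed.

Lemma full_galois_group (F : fieldType) (L : splittingFieldType F)
    (f : {poly F}) (n : nat) :
    f \is monic -> size f = n.+1 -> full_galois f ->
    splittingFieldFor 1 (map_poly (in_alg L) f) {:L} ->
  exists rs : n.-tuple L,
    [/\ uniq rs, root (map_poly (in_alg L) f) =i rs & gal_perms rs = [set: 'S_n]].
Proof.
move=> mon_f sz_f full_f L_splits.
have [xs Df _] := L_splits.
have {}Df : map_poly (in_alg L) f = \prod_(x <- xs) ('X - x%:P).
  by apply/eqP; rewrite -eqp_monic ?map_monic ?monic_prod_XsubC.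
have sz_xs : size xs == n.
  by rewrite -eqSS -(size_prod_XsubC xs id) -Df size_map_poly sz_f.
have /andP[uxs full_xs] := full_f L xs Df.
exists (Tuple sz_xs); split => //.
  by move=> x; rewrite -topredE /= Df root_prod_XsubC.
apply: full_tower_gal_perms => //=.
by rewrite -Df; apply: alg_polyOver.
Qed.

(** The first step of the tower already says that [f] is a minimal polynomial. *)
Lemma full_galois_irreducible (F : fieldType) (f : {poly F}) :
  f \is monic -> (1 < size f)%N -> full_galois f -> irreducible_poly f.
Proof.
move=> mon_f f_gt1 full_f; split=> // q q1 qf.
have [L [xs Df]] := splitting_extension mon_f.
have := full_f L xs Df; case: xs Df => [|x xs] Df.
  by move: f_gt1; rewrite -(size_map_poly (in_alg L)) Df big_nil size_poly1.
move=> /andP[_ /= /andP[/eqP deg_x _]].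
have Dm : minPoly 1 x = map_poly (in_alg L) f.
  apply: dvdp_monic_size; rewrite ?monic_minPoly ?map_monic //.
    by apply: minPoly_dvdp; rewrite ?alg_polyOver // Df root_prod_XsubC mem_head.
  by rewrite Df size_minPoly deg_x size_prod_XsubC.
have := @minPoly_irr _ _ 1%AS x (map_poly (in_alg L) q) (alg_polyOver _ _).
rewrite Dm dvdp_map qf eqp_map => /(_ isT)/orP[//|].
by rewrite -size_poly_eq1 size_map_poly (negPf q1).
Qed.

Lemma full_galois_linear (F : fieldType) (f : {poly F}) : size f = 2%N -> full_galois f.
Proof.
move=> sz L xs Df; have := congr1 (size \o @polyseq _) Df.
rewrite /= size_map_poly sz size_prod_XsubC; case: xs Df => [|x [|//]] // Df _.
rewrite /= !andbT adjoin_deg_eq1; have := congr1 (fun p : {poly L} => p`_0) Df.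
rewrite big_seq1 coef_map coefB coefX coefC /= sub0r => /eqP.
rewrite -eqr_oppLR => /eqP <-.
by rewrite rpredN rpredZ ?mem1v.
Qed.

(** * Places of a field of rational functions *)

Lemma fractionP (D : idomainType) (x : {fraction D}) :
  exists a b : D, b != 0 /\ x = tofrac a / tofrac b.
Proof.
elim/quotW: x => r; exists (frac r).1, (frac r).2; split; first exact: denom_ratioP.
rewrite -[_^-1]/(FracField.inv _) -[_ * _]/(FracField.mul _ _) !piE.
apply/eqmodP; rewrite /= FracField.equivfE /FracField.mulf /FracField.invf.
by rewrite !numden_Ratio ?mul1r ?oner_eq0 ?denom_ratioP // mulr1 mulrC.
Qed.

(** The homomorphism induced by [phi] on the localization of [D] at the kernel
    of [phi]. *)
Definition eval_rel (D : idomainType) (F : fieldType) (phi : D -> F) :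
    {fraction D} -> F -> Prop :=
  fun x y => exists a b,
    [/\ phi b != 0, x = tofrac a / tofrac b & y = phi a / phi b].

Lemma eval_rel_hom (D : idomainType) (F : fieldType) (phi : {rmorphism D -> F}) :
  partial_hom (eval_rel phi).
Proof.
have nz b : phi b != 0 -> tofrac b != 0 :> {fraction D}.
  by apply: contraNneq => /eqP; rewrite tofrac_eq0 => /eqP->; rewrite rmorph0.
split.
- by exists 1, 1; rewrite !rmorph1 !divr1 oner_neq0.
- move=> _ _ [a [b [nz_b -> ->]]]; exists (- a), b.
  by rewrite !rmorphN !mulNr.
- move=> _ _ _ _ [a [b [nz_b -> ->]]] [a' [b' [nz_b' -> ->]]].
  exists (a * b' + a' * b), (b * b'); split; first by rewrite rmorphM mulf_neq0.
    by rewrite addf_div ?nz // !rmorphD !rmorphM.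
  by rewrite addf_div // !rmorphD !rmorphM.
- move=> _ _ _ _ [a [b [nz_b -> ->]]] [a' [b' [nz_b' -> ->]]].
  exists (a * a'), (b * b'); split; first by rewrite rmorphM mulf_neq0.
    by rewrite mulf_div !rmorphM.
  by rewrite mulf_div !rmorphM.
move=> _ [a [b [nz_b /esym/eqP ab0 ->]]]; move: ab0.
rewrite mulf_eq0 invr_eq0 (negPf (nz b nz_b)) orbF tofrac_eq0 => /eqP->.
by rewrite rmorph0 mul0r.
Qed.

Lemma eval_rel_tofrac (D : idomainType) (F : fieldType)
    (phi : {rmorphism D -> F}) (a : D) : eval_rel phi (tofrac a) (phi a).
Proof. by exists a, 1; rewrite !rmorph1 !divr1 oner_neq0. Qed.

Definition fraction_const (k : fieldType) : {rmorphism k -> {fraction {poly k}}} :=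
  (@FracField.tofrac {poly k} \o polyC).

Section Pole.

Variables (A B : fieldType) (R : A -> B -> Prop).
Hypothesis homR : partial_hom R.

(** At a pole [x], a monic polynomial with finite coefficients grows like its
    leading term. *)
Lemma monic_at_pole (p : {poly A}) (q : {poly B}) (x : A) : poly_rel R p q -> p \is monic ->
  x != 0 -> R x^-1 0 -> R (p.[x] * x^-1 ^+ (size p).-1) 1.
Proof.
move=> pq mon_p nz_x x_inf.
have Dn : size p = (size p).-1.+1 by rewrite prednK // size_poly_gt0 monic_neq0.
set n := (size p).-1 in Dn *.
rewrite horner_coef Dn big_ord_recr /= mulrDl -[_ * x^+n * _]mulrA.
rewrite -exprMn divff // expr1n mulr1 -lead_coefE (monicP mon_p).
rewrite -[X in R _ X]add0r; apply: (phomD homR); last exact: (phom1 homR).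
rewrite mulr_suml [X in R _ X](_ : 0 = \sum_(i < n) 0); last by rewrite big1.
apply: (phom_sum homR) => i _.
have -> : p`_i * x ^+ i * x^-1 ^+ n = p`_i * (x^-1 ^+ (n - i).-1 * x^-1).
  rewrite -mulrA -exprSr prednK ?subn_gt0 //; congr (_ * _).
  have := subnK (ltnW (ltn_ord i)); move: (nat_of_ord i) => j {1}<-.
  by rewrite exprD mulrCA -exprMn divff // expr1n mulr1.
have := phomM homR (phomX homR (n - i).-1 x_inf) x_inf.
by move/(phomM homR (pq i)); rewrite !mulr0.
Qed.

Lemma monic_at_pole_neq0 (p : {poly A}) (q : {poly B}) (x : A) : poly_rel R p q ->
  p \is monic -> x != 0 -> R x^-1 0 -> p.[x] != 0.
Proof.
move=> pq mon_p nz_x x_inf; have := monic_at_pole pq mon_p nz_x x_inf.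
by move/(phom_neq0 homR) => /(_ (oner_neq0 _)); rewrite mulf_eq0 => /norP[].
Qed.

End Pole.

Section RationalFunctions.

Variable k : fieldType.
Local Notation F := {fraction {poly k}}.
Local Notation cF := (@fraction_const k).
Local Notation T := (tofrac 'X : F).
Local Notation R0 := (eval_rel (horner_eval (0 : k))).

Lemma at0_hom : partial_hom R0.
Proof. exact: eval_rel_hom. Qed.

Lemma at0_tofrac p : R0 (tofrac p) p.[0].
Proof. exact: eval_rel_tofrac. Qed.

Lemma at0_const c : R0 (cF c) c.
Proof. by have := at0_tofrac c%:P; rewrite hornerC. Qed.

Lemma at0_T : R0 T 0.
Proof. by have := at0_tofrac 'X; rewrite hornerX. Qed.

Lemma at0_poly p : poly_rel R0 (map_poly cF p) p.
Proof. by move=> i; rewrite coef_map; apply: at0_const. Qed.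

(** The order of vanishing at [0] decides whether a fraction or its inverse is
    finite. *)
Lemma at0_valuative : valuative R0.
Proof.
move=> x; have [a [b [nz_b ->]]] := fractionP x.
have [->|nz_a] := eqVneq a 0.
  by left; exists 0; rewrite rmorph0 mul0r; apply: (phom0 at0_hom).
have [i [a1 /implyP/(_ nz_a) a10 Da]] := multiplicity_XsubC a 0.
have [j [b1 /implyP/(_ nz_b) b10 Db]] := multiplicity_XsubC b 0.
rewrite polyC0 subr0 in Da Db.
have nzF p : p != 0 -> tofrac p != 0 :> F by rewrite tofrac_eq0.
have nzX n : tofrac 'X^n != 0 :> F by rewrite nzF ?expf_neq0 ?polyX_eq0.
have nzp (p : {poly k}) : ~~ root p 0 -> p != 0.
  by apply: contraNneq => ->; rewrite root0.
have [le_ji|lt_ij] := leqP j i; [left | right].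
  exists ((a1 * 'X^(i - j)).[0] / b1.[0]), (a1 * 'X^(i - j)), b1.
  split=> //; rewrite Da Db -{1}(subnK le_ji) exprD mulrA !tofracM.
  by rewrite -mulf_div divff ?mulr1.
exists (b1 * 'X^(j - i)), a1; split=> //.
  rewrite invf_div Da Db -{1}(subnK (ltnW lt_ij)) exprD mulrA !tofracM.
  by rewrite -mulf_div divff ?mulr1.
by rewrite /horner_eval hornerM hornerXn expr0n subn_eq0 leqNgt lt_ij mulr0 mul0r.
Qed.

(** Specialization at the place [T = 0], where the degree does not drop. *)
Lemma full_galois_pencil0 (P Q : {poly k}) : P \is monic -> (size Q < size P)%N ->
  full_galois P -> full_galois (map_poly cF P + T *: map_poly cF Q).
Proof.
move=> mon_P ltQP; apply: (full_galois_specialize at0_hom at0_valuative).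
  have sz : (size (T *: map_poly cF Q) < size (map_poly cF P))%N.
    by rewrite (leq_ltn_trans (size_scale_leq _ _)) // !size_map_poly.
  by rewrite monicE lead_coefDl // -monicE map_monic.
rewrite -[P in poly_rel _ _ P]addr0 -(scale0r Q).
apply: (prelD at0_hom); first exact: at0_poly.
by apply: (prelZ at0_hom); [apply: at0_T | apply: at0_poly].
Qed.

End RationalFunctions.

(** * The pencil P + T Q for T tending to infinity *)

(** The rational root theorem: in lowest terms, the denominator divides a power
    of the numerator. *)
Lemma fraction_poly_integral (k : fieldType) (p : {poly {poly k}})
    (z : {fraction {poly k}}) : p \is monic ->
  root (map_poly (@FracField.tofrac {poly k}) p) z ->
  exists d, z = FracField.tofrac d.
Proof.
move=> mon_p; have [a0 [b0 [nz_b0 Dz]]] := fractionP z.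
pose a := a0 %/ gcdp a0 b0; pose b := b0 %/ gcdp a0 b0.
have co_ab : coprimep a b by rewrite coprimep_div_gcd ?nz_b0 ?orbT.
have Da : a0 = a * gcdp a0 b0 by rewrite divpK ?dvdp_gcdl.
have Db : b0 = b * gcdp a0 b0 by rewrite divpK ?dvdp_gcdr.
have nz_g : gcdp a0 b0 != 0 by rewrite gcdp_eq0 negb_and nz_b0 orbT.
have nz_b : b != 0 by apply: contraNneq nz_b0 => b_0; rewrite Db b_0 mul0r.
have {}Dz : z = tofrac a / tofrac b.
  rewrite Dz [X in tofrac X / _]Da [X in _ / tofrac X]Db !tofracM -mulf_div.
  by rewrite divff ?mulr1 ?tofrac_eq0.
have nz_bF : tofrac b != 0 :> {fraction {poly k}} by rewrite tofrac_eq0.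
have Dn : size p = (size p).-1.+1 by rewrite prednK // size_poly_gt0 monic_neq0.
set n := (size p).-1 in Dn *; move/rootP => pz0.
have eq_an : a ^+ n = - \sum_(i < n) p`_i * a ^+ i * b ^+ (n - i).
  apply/eqP; rewrite -subr_eq0 opprK -tofrac_eq0 tofracD addrC rmorph_sum /=.
  have {}pz0 : (map_poly (@FracField.tofrac {poly k}) p).[z] * tofrac b ^+ n = 0.
    by rewrite pz0 mul0r.
  apply/eqP/(etrans _ pz0); rewrite horner_coef.
  rewrite size_map_inj_poly ?rmorph0 //; last by move=> u v /eqP; rewrite tofrac_eq => /eqP.
  rewrite Dn big_ord_recr /= mulrDl mulr_suml coef_map /= -lead_coefE (monicP mon_p).
  have zb : z * tofrac b = tofrac a by rewrite Dz divfK.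
  rewrite tofrac1 mul1r -exprMn zb tofracXn; congr (_ + _).
  apply: eq_bigr => i _; rewrite coef_map /= !tofracM !tofracXn -!mulrA.
  congr (_ * _); have := subnKC (ltnW (ltn_ord i)); move: (nat_of_ord i) => j {2}<-.
  by rewrite exprD mulrA -exprMn zb.
have b_dvd : b %| a ^+ n.
  rewrite eq_an dvdpNr.
  apply: (big_ind (fun u => b %| u)) => [|u v|i _]; first exact: dvdp0.
    exact: dvdp_add.
  by rewrite dvdp_mull // -{1}(expr1 b) dvdp_exp2l ?subn_gt0.
have : size b == 1%N.
  move: co_ab; rewrite coprimep_sym => /(coprimep_expr n)/coprimepP.
  by move/(_ b (dvdpp b) b_dvd); rewrite -size_poly_eq1.
case/size_poly1P=> c nz_c {}Db; exists (c^-1 *: a); rewrite Dz Db.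
apply: (canLR (mulfK _)); first by rewrite tofrac_eq0 polyC_eq0.
by rewrite -tofracM mulrC mul_polyC scalerA divff // scale1r.
Qed.

Lemma map_poly_at_pole_neq0 (k F : fieldType) (cF : {rmorphism k -> F})
    (R : F -> k -> Prop) : partial_hom R ->
    (forall p, poly_rel R (map_poly cF p) p) ->
  forall b x, b != 0 -> x != 0 -> R x^-1 0 -> (map_poly cF b).[x] != 0.
Proof.
move=> homR cFR b x nz_b nz_x x_oo.
have nz_l : lead_coef b != 0 by rewrite lead_coef_eq0.
have -> : b = lead_coef b *: ((lead_coef b)^-1 *: b).
  by rewrite scalerA divff ?scale1r.
rewrite map_polyZ hornerZ mulf_neq0 ?fmorph_eq0 //.
apply: (monic_at_pole_neq0 homR (cFR _) _ nz_x x_oo).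
by rewrite map_monic monicE lead_coefZ mulVf.
Qed.

Lemma mul_exp_quotient (F : fieldType) (x y u : F) n : u != 0 ->
  x * u ^+ n.+1 * (y * u ^+ n)^-1 = u * (x / y).
Proof.
move=> nz_u; rewrite exprS mulrA -mulf_div divff ?expf_neq0 // mulr1.
by rewrite mulrA [u * x]mulrC.
Qed.

Section Pencil.

Variables (k : fieldType) (P Q : {poly k}).
Hypotheses (mon_P : P \is monic) (mon_Q : Q \is monic).
Hypotheses (size_PQ : size P = (size Q).+1) (Q_gt1 : (1 < size Q)%N).
Hypothesis co_PQ : coprimep P Q.

Local Notation F := {fraction {poly k}}.
Local Notation cF := (@fraction_const k).
Local Notation T := (tofrac 'X : F).

Let f := map_poly cF P + T *: map_poly cF Q.

(** A root would be a polynomial [d] by [fraction_poly_integral], with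
    [P(d) = - T Q(d)].  A Bezout relation between [P] and [Q] then makes [Q(d)]
    invertible, which forces [d] to be constant, and then the equation cannot
    hold in degree [1]. *)
Lemma pencil_no_root z : ~~ root f z.
Proof.
apply/negP => fz0.
pose p := map_poly polyC P + 'X *: map_poly polyC Q.
have Df : f = map_poly (@FracField.tofrac {poly k}) p.
  by rewrite rmorphD /= map_polyZ /= -!map_poly_comp.
have mon_p : p \is monic.
  have sz : (size ('X *: map_poly polyC Q) < size (map_poly polyC P))%N.
    rewrite (leq_ltn_trans (size_scale_leq _ _)) //.
    by rewrite !size_map_polyC size_PQ.
  by rewrite monicE lead_coefDl // -monicE monic_map.
rewrite Df in fz0; have [d Dz] := fraction_poly_integral mon_p fz0.
have pd : P \Po d = - ('X * (Q \Po d)).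
  apply/eqP; rewrite -subr_eq0 opprK; move/rootP: fz0.
  rewrite Dz horner_map /= => /eqP; rewrite tofrac_eq0.
  by rewrite hornerD hornerZ.
have /Bezout_eq1_coprimepP[[u v] /= uv1] := co_PQ.
have Qd_unit : Q \Po d %| 1.
  have := congr1 (comp_poly d) uv1; rewrite rmorphD !rmorphM /= rmorph1 => <-.
  by rewrite pd mulrN dvdp_add ?dvdpNr ?dvdp_mull // dvdp_mulIr.
have size_Qd : size (Q \Po d) = 1%N.
  by apply/eqP; rewrite -dvdp1.
have size_d : (size d <= 1)%N.
  have := size_comp_poly Q d; rewrite size_Qd /=.
  move/esym/eqP; rewrite muln_eq0 -!subn1 !subn_eq0 leqNgt Q_gt1 /=.
  by [].
move: pd size_Qd; rewrite (size1_polyC size_d) !comp_polyCr.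
move/(congr1 (coefp 1)); rewrite /= coefN coefXM !coefC /=.
by move/eqP; rewrite eq_sym oppr_eq0 => /eqP->; rewrite size_poly0.
Qed.

End Pencil.

(** The field [F] stands for the rational functions over [k] in one variable
    [T]: [R0] is the place [T = 0], and by [subst_T] any element [c] with a pole
    there can be substituted for [T], being transcendental over [k]. *)
Section PencilAtInfinity.

Variables (k F : fieldType) (cF : {rmorphism k -> F}) (T : F).
Variable R0 : F -> k -> Prop.
Hypotheses (homR0 : partial_hom R0) (valR0 : valuative R0).
Hypotheses (cFR0 : forall d, R0 (cF d) d) (R0T : R0 T 0) (nz_T : T != 0).
Hypothesis subst_T : forall c, c != 0 -> R0 c^-1 0 ->
  exists R1 : F -> F -> Prop, [/\ partial_hom R1, forall x, exists y, R1 x y,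
    forall d, R1 (cF d) (cF d) & R1 T c].

Variables (P Q : {poly k}).
Hypotheses (mon_P : P \is monic) (mon_Q : Q \is monic).
Hypotheses (size_PQ : size P = (size Q).+1) (Q_gt1 : (1 < size Q)%N).

Let f := map_poly cF P + T *: map_poly cF Q.
Hypothesis pencil_no_root : forall z, ~~ root f z.

Let cF_poly p : poly_rel R0 (map_poly cF p) p.
Proof. by move=> i; rewrite coef_map; apply: cFR0. Qed.

Lemma pencil_monic c : map_poly cF P + c *: map_poly cF Q \is monic.
Proof.
have sz : (size (c *: map_poly cF Q) < size (map_poly cF P))%N.
  by rewrite (leq_ltn_trans (size_scale_leq _ _)) // !size_map_poly size_PQ.
by rewrite monicE lead_coefDl // -monicE map_monic.
Qed.

(** The embedding [R1] of [F] into itself replaces [T] by [c = - P(a) / Q(a)],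
    where [a = 1 / T]; it makes [a] a root of the image [f1] of [f].  The cofactor
    [g] of [X - a] in [f1] reduces to [Q] at the pole [a] of the place [R0], so it
    is full.  Irreducibility of [f] allows to extend [R1] to one root [x] of [f]
    with [x] sent to [a], and the other roots are compared with those of [g]. *)
Lemma full_galois_infinity : full_galois Q -> full_galois f.
Proof.
move=> full_Q; pose a : F := T^-1.
have nz_a : a != 0 by rewrite invr_eq0.
have a_oo : R0 a^-1 0 by rewrite invrK; apply: R0T.
have mon_Pc : map_poly cF P \is monic by rewrite map_monic.
have mon_Qc : map_poly cF Q \is monic by rewrite map_monic.
have Pa_oo := monic_at_pole homR0 (cF_poly P) mon_Pc nz_a a_oo.
have Qa_oo := monic_at_pole homR0 (cF_poly Q) mon_Qc nz_a a_oo.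
have nz_Qa := monic_at_pole_neq0 homR0 (cF_poly Q) mon_Qc nz_a a_oo.
set Pa := (map_poly cF P).[a] in Pa_oo; set Qa := _.[a] in Qa_oo nz_Qa.
pose c := - (Pa / Qa).
have R0V x y : R0 x y -> y != 0 -> R0 x^-1 y^-1.
  by move=> Rxy; apply: (phomV homR0 Rxy); apply: valR0.
have Tc : R0 (T * c) (-1).
  have := R0V _ _ Qa_oo (oner_neq0 _); rewrite invr1.
  move/(phomM homR0 Pa_oo)/(phomN homR0); rewrite mulr1.
  have [n Dn] : exists n, size Q = n.+1 by case: (size Q) Q_gt1 => // n; exists n.
  rewrite !size_map_poly size_PQ Dn /=.
  by rewrite (mul_exp_quotient _ _ _ (invr_neq0 nz_a)) invrK mulrN.
pose f1 := map_poly cF P + c *: map_poly cF Q.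
have mon_f1 : f1 \is monic by apply: pencil_monic.
have f1a0 : root f1 a.
  by rewrite /root hornerD hornerZ -/Pa -/Qa /c mulNr divfK // subrr.
have /factor_theorem[g Df1] := f1a0.
have mon_g : g \is monic by rewrite -(monicMr _ (monicXsubC a)) -Df1.
have gQ : poly_rel R0 g Q.
  (* Multiplying [f1 = g * (X - a)] by [- T = - 1 / a] gives [g * (1 - T X)], whose
     coefficients are finite; those of [g] follow by solving from degree [0] on. *)
  have hQ : poly_rel R0 (g - T *: (g * 'X)) Q.
    have -> : g - T *: (g * 'X) = - T *: map_poly cF P - (T * c) *: map_poly cF Q.
      transitivity (- T *: f1); last first.
        by rewrite /f1 scalerDr scalerA mulNr !scaleNr.
      rewrite Df1 scaleNr -scalerN -mulrN opprB mulrBr scalerBr.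
      by rewrite [g * a%:P]mulrC mul_polyC scalerA divff // scale1r.
    have DQ : Q = - 0 *: P - (-1) *: Q by rewrite oppr0 scale0r scaleN1r opprK add0r.
    rewrite [X in poly_rel _ _ X]DQ; apply: (prelB homR0).
      exact: (prelZ homR0 (phomN homR0 R0T) (cF_poly P)).
    exact: (prelZ homR0 Tc (cF_poly Q)).
  move=> i; elim: i => [|i IHi].
    by have := hQ 0%N; rewrite coefB coefZ coefMX mulr0 subr0.
  have := phomD homR0 (hQ i.+1) (phomM homR0 R0T IHi).
  by rewrite coefB coefZ coefMX subrK mul0r addr0.
have full_g : full_galois g.
  exact: (full_galois_specialize homR0 valR0 mon_g gQ full_Q).
have nz_ga : g.[a] != 0 := monic_at_pole_neq0 homR0 gQ mon_g nz_a a_oo.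
have nz_c : c != 0.
  have := phom_neq0 homR0 Tc; rewrite oppr_eq0 oner_eq0 => /(_ isT).
  by rewrite mulf_eq0 => /norP[].
have c_oo : R0 c^-1 0.
  have := R0V _ _ Tc; rewrite oppr_eq0 oner_eq0 => /(_ isT).
  move/(phomM homR0 R0T); rewrite mul0r invfM mulrA divff //.
  by rewrite mul1r.
have [R1 [hom1 tot1 cR1 R1T]] := subst_T nz_c c_oo.
have ff1 : poly_rel R1 f f1.
  apply: (prelD hom1); first by move=> i; rewrite !coef_map; apply: cR1.
  by apply: (prelZ hom1 R1T) => i; rewrite !coef_map; apply: cR1.
move=> L xs Df; have [L' [ys Dg]] := splitting_extension mon_g.
have /andP[uys full_ys] := full_g L' ys Dg.
have val1 : valuative R1 by move=> x; left.
have plR := base_place L L' hom1 val1.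
set R : L -> L' -> Prop := @base_rel _ _ _ _ _ in plR.
have homR : partial_hom R := place_hom plR.
have ffL : poly_rel R (map_poly (in_alg L) f) (map_poly (in_alg L') f1).
  exact: base_poly_rel.
have Kf : map_poly (in_alg L) f \is a polyOver 1%VS by apply: alg_polyOver.
have Df1L : map_poly (in_alg L') f1 = ('X - (a%:A)%:P) * \prod_(y <- ys) ('X - y%:P).
  by rewrite Df1 mulrC rmorphM /= map_polyXsubC Dg.
have mon_f : f \is monic by apply: pencil_monic.
have mon_fL : map_poly (in_alg L) f \is monic by rewrite map_monic.
have size_f : size f = size P.
  have sz : (size (T *: map_poly cF Q) < size (map_poly cF P))%N.
    by rewrite (leq_ltn_trans (size_scale_leq _ _)) // !size_map_poly size_PQ.
  by rewrite size_polyDl // size_map_poly.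
have size_xs : size xs = size Q.
  apply: succn_inj; rewrite -size_PQ -size_f -(size_map_poly (in_alg L)) Df.
  by rewrite size_prod_XsubC.
have size_ys : (size ys).+1 = size Q.
  rewrite -(size_prod_XsubC ys id) -Dg size_map_poly.
  by have [_ ->] := prel_monic homR0 gQ mon_g.
have no_root1 (h : {poly L}) : h \is a polyOver 1%VS -> h \is monic ->
    size h = 2%N -> ~~ (h %| map_poly (in_alg L) f).
  move=> Kh mon_h size_h; apply/negP => hf.
  have /vlineP[z Dz] : - h`_0 \in 1%VS by rewrite rpredN (polyOverP Kh).
  have hz : root h z%:A.
    have h1 : h`_1 = 1 by move: (monicP mon_h); rewrite lead_coefE size_h.
    rewrite -Dz /root horner_coef size_h !big_ord_recr big_ord0 /= h1.
    by rewrite add0r expr0 mulr1 mul1r expr1 subrr.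
  have /negP[] := pencil_no_root z; rewrite -(fmorph_root (in_alg L)).
  by have /dvdpP[w ->] := hf; rewrite rootM hz orbT.
case: xs Df size_xs => [|x xs] Df size_xs; first by move: Q_gt1; rewrite -size_xs.
case: ys uys full_ys Dg Df1L size_ys => [|y ys] uys full_ys Dg Df1L size_ys.
  by move: Q_gt1; rewrite -size_ys.
have fx : root (map_poly (in_alg L) f) x by rewrite Df root_prod_XsubC mem_head.
pose m := minPoly 1 x; pose h := map_poly (in_alg L) f %/ m.
have mf : m %| map_poly (in_alg L) f by apply: minPoly_dvdp.
have Dmh : map_poly (in_alg L) f = m * h by rewrite mulrC divpK.
have mon_m : m \is monic by apply: monic_minPoly.
have mon_h : h \is monic by rewrite -(monicMl _ mon_m) -Dmh.
have Km : m \is a polyOver 1%VS by apply: minPolyOver.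
have Kh : h \is a polyOver 1%VS by apply: divp_polyOver.
have [m' [h' [mm' hh' Dmh']]] := gauss_monic plR ffL Dmh mon_m mon_h Km Kh.
have [mon_m' size_m'] := prel_monic homR mm' mon_m.
have [mon_h' size_h'] := prel_monic homR hh' mon_h.
have [_ Km'] := prel_over plR mm'; have [_ Kh'] := prel_over plR hh'.
set gL := \prod_(z <- y :: ys) ('X - z%:P) in Dg Df1L.
have mon_gL : gL \is monic by apply: monic_prod_XsubC.
have Dgy : minPoly 1 y = gL.
  apply: dvdp_monic_size; rewrite ?monic_minPoly //.
    apply: minPoly_dvdp; rewrite -?Dg ?alg_polyOver // Dg.
    by rewrite root_prod_XsubC mem_head.
  by move: full_ys => /= /andP[/eqP deg_y _]; rewrite size_minPoly deg_y size_prod_XsubC.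
(* In a factorization [m * h] of [f], the image of one factor is divisible by the
   irreducible [gL], so the other factor is at most linear; a linear factor is
   excluded because [f] has no root. *)
have linear_cofactor (u v : {poly L'}) : u \is monic -> v \is monic ->
    u \is a polyOver 1%VS -> root u y ->
    map_poly (in_alg L') f1 = u * v -> (size v <= 2)%N.
  move=> mon_u mon_v Ku uy Duv.
  have /dvdpP[w Du] : gL %| u by rewrite -Dgy minPoly_dvdp.
  have vX : v %| 'X - (a%:A)%:P.
    apply/dvdpP; exists w; apply: (mulIf (monic_neq0 mon_gL)).
    by rewrite -Df1L Duv Du mulrAC.
  by rewrite (leq_trans (dvdp_leq _ vX)) ?polyXsubC_eq0 ?size_XsubC.
have size_h1 : size h = 1%N.
  have : root (map_poly (in_alg L') f1) y.
    by rewrite Df1L rootM root_prod_XsubC mem_head orbT.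
  rewrite Dmh' rootM => /orP[m'y|h'y].
    have := linear_cofactor _ _ mon_m' mon_h' Km' m'y Dmh'.
    rewrite size_h'; case Dsz: (size h) => [|[|[|]]] // _.
      by move/eqP: Dsz; rewrite size_poly_eq0 (negPf (monic_neq0 mon_h)).
    by have := no_root1 h Kh mon_h Dsz; rewrite Dmh dvdp_mull.
  have := linear_cofactor _ _ mon_h' mon_m' Kh' h'y; rewrite mulrC => /(_ Dmh').
  rewrite size_m'; case Dsz: (size m) => [|[|[|]]] // _.
  - by rewrite size_minPoly in Dsz.
  - by rewrite size_minPoly in Dsz.
  by have := no_root1 m Km mon_m Dsz; rewrite mf.
have Dm : m = map_poly (in_alg L) f.
  rewrite Dmh; have -> : h = 1; last by rewrite mulr1.
  by apply/eqP; rewrite -eqp_monic ?rpred1 // -size_poly_eq1 size_h1.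
have mf1 : poly_rel R (minPoly 1 x) (map_poly (in_alg L') f1).
  by rewrite -/m Dm; apply: ffL.
have f1a : root (map_poly (in_alg L') f1) a%:A.
  by rewrite Df1L rootM root_XsubC eqxx.
have totR u : u \in 1%VS -> exists v, R u v.
  case/vlineP=> w ->; have [v Rwv] := tot1 w.
  by exists v%:A, w, v.
(* [a] lies in the base field, so the residue field is not enlarged. *)
have := adjoin_place_total plR mf1 f1a totR.
have -> : <<1; a%:A>>%AS = 1%AS :> {subfield L'}.
  by apply: val_inj; apply/Fadjoin_idP; rewrite rpredZ ?mem1v.
move=> plR'; have homR' := place_hom plR'.
have Rxa : adjoin_rel R x a%:A x a%:A := adjoin_rel_gen plR x a%:A.
have ggL : poly_rel (adjoin_rel R x a%:A) (\prod_(z <- xs) ('X - z%:P)) gL.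
  apply: (prel_divXsubC plR' Rxa (monic_prod_XsubC _ _ _)).
  rewrite -Df1L; move: Df; rewrite big_cons => <-.
  exact: (prel_adjoin plR x a%:A ffL).
have /andP[uxs full_xs] := full_specialize plR' ggL uys full_ys.
rewrite /= uxs full_xs !andbT; apply/andP; split; last first.
  rewrite -eqSS -size_minPoly -/m Dm size_map_poly size_f size_PQ -size_xs.
  by rewrite eqxx.
apply: contra nz_ga => xs_x.
rewrite -[_ == 0]/(root g a) -(fmorph_root (in_alg L')) Dg.
apply/rootP; have := prel_horner homR' ggL Rxa.
rewrite (rootP (_ : root _ x)); last by rewrite root_prod_XsubC.
exact: (phom0_eq0 homR').
Qed.

End PencilAtInfinity.

Lemma full_galois_pencil_oo (k : fieldType) (P Q : {poly k}) :
    P \is monic -> Q \is monic -> size P = (size Q).+1 -> (1 < size Q)%N ->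
    coprimep P Q -> full_galois Q ->
  full_galois (map_poly (@fraction_const k) P +
    (FracField.tofrac 'X : {fraction {poly k}}) *: map_poly (@fraction_const k) Q).
Proof.
move=> mon_P mon_Q size_PQ Q_gt1 co_PQ.
apply: (full_galois_infinity (at0_hom k) (@at0_valuative k) (@at0_const k) (at0_T k)) => //.
- by rewrite tofrac_eq0 polyX_eq0.
- move=> c nz_c c_oo.
  (* Substitution of [c] is injective: a nonzero polynomial over [k] does not
     vanish at a pole. *)
  pose phi : {rmorphism {poly k} -> {fraction {poly k}}} :=
    horner_eval c \o map_poly (@fraction_const k).
  have phi_inj b : b != 0 -> phi b != 0.
    by move=> nz_b; apply: (map_poly_at_pole_neq0 (at0_hom k) (@at0_poly k)).
  exists (eval_rel phi); split.
  - exact: eval_rel_hom.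
  - move=> x; have [u [v [nz_v ->]]] := fractionP x.
    by exists (phi u / phi v), u, v; rewrite phi_inj.
  - move=> d; have := eval_rel_tofrac phi d%:P.
    by rewrite /phi /= /horner_eval map_polyC hornerC.
  have := eval_rel_tofrac phi 'X.
  by rewrite /phi /= /horner_eval map_polyX hornerX.
exact: pencil_no_root.
Qed.

(** * Isolating one variable *)

Lemma eq_mpoly_rmorph (n : nat) (A : nzRingType) (B : comNzRingType)
    (f g : {rmorphism {mpoly A[n]} -> B}) :
  (forall c, f c%:MP = g c%:MP) -> (forall i, f 'X_i = g 'X_i) -> f =1 g.
Proof.
move=> eqC eqX p; rewrite [p]mpolyE !rmorph_sum; apply: eq_bigr => m _.
rewrite -mul_mpolyC !rmorphM /= eqC mpolyXE_id !rmorph_prod; congr (_ * _).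
by apply: eq_bigr => i _; rewrite !rmorphXn /= eqX.
Qed.

Section GenericVariable.

Variables (E : finType) (K : fieldType) (e : E).
Local Notation k := (ratfun E K).
Local Notation F := {fraction {poly k}}.

Let constK : {rmorphism K -> {poly k}} :=
  polyC \o (@FracField.tofrac {mpoly K[#|E|]} \o @mpolyC #|E| K).

Let isolate (i : 'I_#|E|) : {poly k} :=
  if i == enum_rank e then 'X else (FracField.tofrac ('X_i : {mpoly K[#|E|]}))%:P.

Let split_var : {rmorphism {mpoly K[#|E|]} -> {poly k}} := mmap constK isolate.

(** Every other variable is treated as a constant and [v_e] as the variable of
    rational functions over a second copy of the whole field.  Since the constant
    field is larger than needed, this is only an embedding; its injectivity is
    seen by evaluating the polynomial variable at [v_e]. *)
Lemma generic_variable : exists R : k -> F -> Prop,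
  [/\ partial_hom R, valuative R, R (var K e) (FracField.tofrac 'X)
    & forall f, f != e -> R (var K f) (fraction_const k (var K f))].
Proof.
pose phi : {rmorphism {mpoly K[#|E|]} -> F} := @FracField.tofrac {poly k} \o split_var.
have XE i : split_var 'X_i = isolate i.
  by rewrite /split_var /= mmapX mmap1U.
have evalE p : (split_var p).[var K e] = FracField.tofrac p.
  apply: (@eq_mpoly_rmorph _ _ _ (horner_eval (var K e) \o split_var)
    (@FracField.tofrac {mpoly K[#|E|]})) => [c|i].
    by rewrite /= /split_var /= mmapC /= /horner_eval hornerC.
  rewrite /= /horner_eval XE /isolate; case: eqP => [->|_].
    by rewrite hornerX.
  by rewrite hornerC.
have phi_inj p : p != 0 -> phi p != 0.
  move=> nz_p; rewrite /phi [_ p]/= tofrac_eq0; apply: contraNneq nz_p => p0.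
  have := congr1 (horner^~ (var K e)) p0; rewrite evalE horner0.
  by move/eqP; rewrite tofrac_eq0.
exists (eval_rel phi); split.
- exact: eval_rel_hom.
- move=> x; have [a [b [nz_b ->]]] := fractionP x.
  by left; exists (phi a / phi b), a, b; rewrite phi_inj.
- by have := eval_rel_tofrac phi 'X_(enum_rank e); rewrite /phi /= XE /isolate eqxx.
move=> f fe; have := eval_rel_tofrac phi 'X_(enum_rank f).
by rewrite /phi /= XE /isolate (inj_eq enum_rank_inj) (negPf fe).
Qed.

End GenericVariable.

(** * Matroid rank functions *)

Record rank_function (E : finType) (r : {set E} -> nat) : Prop := RankFunction {
  rank0 : r set0 = 0%N;
  rank1 : forall e, (r [set e] <= 1)%N;
  rank_mono : forall A B : {set E}, A \subset B -> (r A <= r B)%N;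
  rank_submod : forall A B : {set E}, (r (A :&: B) + r (A :|: B) <= r A + r B)%N
}.

Section MatroidRank.

Variables (E : finType) (M : matroid E).

(** A maximal independent set between [I] and [A] has the cardinality of every
    other maximal one, by augmentation. *)
Lemma indep_extension (I A : {set E}) : I \in indep M -> I \subset A ->
  exists J : {set E}, [/\ J \in indep M, I \subset J, J \subset A & #|J| = mrank M A].
Proof.
move=> indI IA.
pose P := [pred J : {set E} | [&& J \in indep M, I \subset J & J \subset A]].
have [|J maxJ IJ] := @maxset_exists _ P I; first by rewrite /= indI subxx IA.
have /maxsetP[/and3P[indJ _ JA] max_J] := maxJ.
exists J; split => //; apply/eqP; rewrite eqn_leq; apply/andP; split.
  by rewrite /mrank (bigmax_sup J) // indJ.
apply/bigmax_leqP => I' /andP[indI' I'A]; rewrite leqNgt; apply/negP => ltJ.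
have [e /setDP[I'e J'e] indeJ] := indep_augment indJ indI' ltJ.
suff DJ : e |: J = J by rewrite -DJ setU11 in J'e.
apply: max_J; last exact: subsetUr.
rewrite /= indeJ (subset_trans IJ (subsetUr _ _)) subUset JA sub1set.
by rewrite (subsetP I'A).
Qed.

Lemma leq_mrank (I A : {set E}) : I \in indep M -> I \subset A ->
  (#|I| <= mrank M A)%N.
Proof. by move=> indI IA; rewrite /mrank (bigmax_sup I) // indI. Qed.

Lemma mrank_indep (I : {set E}) : I \in indep M -> mrank M I = #|I|.
Proof.
move=> indI; apply/eqP; rewrite eqn_leq leq_mrank // andbT.
by apply/bigmax_leqP => J /andP[_ /subset_leq_card].
Qed.

(** For submodularity, extend a basis [I] of the intersection to a basis [J] of
    the union, and count the elements of [J] in [A] and in [B]. *)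
Lemma mrank_rank_function : rank_function (mrank M).
Proof.
split.
- apply/eqP; rewrite -leqn0; apply/bigmax_leqP => I /andP[_ /subset_leq_card].
  by rewrite cards0.
- by move=> e; apply/bigmax_leqP => I /andP[_ /subset_leq_card]; rewrite cards1.
- move=> A B AB; apply/bigmax_leqP => I /andP[indI IA].
  exact: leq_mrank (subset_trans IA AB).
move=> A B.
have [I [indI _ IAB cardI]] := indep_extension (indep_set0 M) (sub0set (A :&: B)).
have IU : I \subset A :|: B.
  by rewrite (subset_trans IAB) // (subset_trans (subsetIl A B)) ?subsetUl.
have [J [indJ IJ JU cardJ]] := indep_extension indI IU.
rewrite -cardI -cardJ.
have leA : (#|J :&: A| <= mrank M A)%N.
  by apply: leq_mrank (subsetIr _ _); apply: indep_sub indJ; apply: subsetIl.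
have leB : (#|J :&: B| <= mrank M B)%N.
  by apply: leq_mrank (subsetIr _ _); apply: indep_sub indJ; apply: subsetIl.
apply: leq_trans (leq_add leA leB).
rewrite -[X in (_ <= X)%N]cardsUI -setIUr (setIidPl JU) addnC leq_add2l subset_leq_card //.
by rewrite -setIIr subsetI IJ.
Qed.

End MatroidRank.

(** Connectedness as the absence of a separation, which passes to minors more
    easily than the existence of common circuits. *)
Definition rank_connected (E : finType) (r : {set E} -> nat) (S : {set E}) :=
  [forall A : {set E}, (A \subset S) && (A != set0) && (A != S) ==>
     (r S < r A + r (S :\: A))%N].

Lemma rank_connectedP (E : finType) (r : {set E} -> nat) (S : {set E}) :
  reflect (forall A : {set E}, A \subset S -> A != set0 -> A != S ->
             (r S < r A + r (S :\: A))%N)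
          (rank_connected r S).
Proof.
apply: (iffP forallP) => [conn A AS A0 nAS|conn A].
  by have := conn A; rewrite AS A0 nAS.
by apply/implyP => /andP[/andP[]]; apply: conn.
Qed.

(** A separation splits a circuit that meets both sides into two proper, hence
    independent, parts whose cardinalities add up to the rank of the circuit. *)
Lemma mconnected_rank (E : finType) (M : matroid E) : mconnected M ->
  rank_connected (mrank M) [set: E].
Proof.
move=> conn; apply/rank_connectedP => A _ /set0Pn[e Ae].
rewrite -properT => /properP[_ [f _ A'f]].
have ef : e != f by apply: contraNneq A'f => <-.
have [C [circC Ce Cf]] := conn e f ef.
have rkM := mrank_rank_function M.
have /minsetP[/= depC minC] := circC.
have indP (D : {set E}) : D \subset C -> D != C -> D \in indep M.
  by move=> DC nDC; apply: contraNT nDC => /minC->.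
have rC : (mrank M C < #|C|)%N.
  have [I [indI _ IC <-]] := indep_extension (indep_set0 M) (sub0set C).
  rewrite ltn_neqAle subset_leq_card // andbT; apply: contraNneq depC => eqIC.
  by have /eqP<- : I == C by rewrite eqEcard IC eqIC leqnn.
have rA : mrank M (C :&: A) = #|C :&: A|.
  apply/mrank_indep/indP; first exact: subsetIl.
  by apply: contraNneq A'f => /setIidPl/subsetP; apply.
have rA' : mrank M (C :\: A) = #|C :\: A|.
  apply/mrank_indep/indP; first exact: subsetDl.
  by apply: contraTneq Ce => <-; rewrite inE Ae.
(* Submodularity for [C] and [A], then for their union and the complement of [A]:
   the separation of the ground set is pushed down to [C]. *)
have := rank_submod rkM C A; have := rank_submod rkM (C :|: A) (~: A).
rewrite setTD -(cardsID A C) -rA -rA' in rC *.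
have -> : (C :|: A) :&: ~: A = C :\: A.
  by rewrite setIUl setICr setU0 -setDE.
have -> : C :|: A :|: ~: A = [set: E] by rewrite -setUA setUCr setUT.
by move: rC; lia.
Qed.

Definition contraction (E : finType) (r : {set E} -> nat) (e : E) :
  {set E} -> nat := fun A => (r (e |: A) - r [set e])%N.

Section Rank.

Variables (E : finType) (r : {set E} -> nat).
Hypothesis rank_r : rank_function r.
Implicit Types (A B C D S : {set E}) (e f : E).

Lemma rank_U1 e A : (r (e |: A) <= r [set e] + r A)%N.
Proof. by have := rank_submod rank_r [set e] A; lia. Qed.

Lemma leq_rank_U1 e A : (r [set e] <= r (e |: A))%N.
Proof. by apply: (rank_mono rank_r); apply: subsetUl. Qed.

Lemma contraction_rank e : rank_function (contraction r e).
Proof.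
split=> [|f|A B AB|A B]; rewrite /contraction.
- by rewrite setU0 subnn.
- by have := rank_U1 f [set e]; have := rank1 rank_r f; rewrite setUC; lia.
- by rewrite leq_sub2r // (rank_mono rank_r) // setUS.
have := rank_submod rank_r (e |: A) (e |: B); rewrite -setUIr -setUUr.
have := leq_rank_U1 e (A :&: B); have := leq_rank_U1 e (A :|: B).
by have := leq_rank_U1 e A; have := leq_rank_U1 e B; lia.
Qed.

Lemma connected_loopless S f : rank_connected r S -> (0 < r S)%N -> f \in S ->
  r [set f] = 1%N.
Proof.
move=> /rank_connectedP conn rS Sf.
have := rank1 rank_r f; case Df : (r [set f]) => [|[|//]] // _.
have [DS|nDS] := eqVneq [set f] S; first by move: rS; rewrite -DS Df.
have := conn [set f]; rewrite sub1set Sf -card_gt0 cards1 nDS Df => /(_ isT isT isT).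
by rewrite add0n ltnNge (rank_mono rank_r) ?subsetDl.
Qed.

Lemma connected_coloopless S e : rank_connected r S -> e \in S -> S != [set e] ->
  r (S :\ e) = r S.
Proof.
move=> /rank_connectedP conn Se nS; apply/eqP; rewrite eqn_leq.
rewrite (rank_mono rank_r) ?subsetDl //=.
have := conn [set e]; rewrite sub1set Se -card_gt0 cards1 eq_sym nS.
by move=> /(_ isT isT isT); have := rank1 rank_r e; lia.
Qed.

(** Submodularity for [A] and [C + e], and for their complements, bounds the right
    hand side below by the ranks of two complementary pairs of nonempty sets; each
    pair exceeds the rank of [S] because [S] is connected. *)
Lemma uncrossing S e A C : rank_connected r S -> e \in S ->
    A \subset S :\ e -> C \subset S :\ e ->
    A :&: C != set0 -> (S :\ e :\: A) :&: (S :\ e :\: C) != set0 ->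
  (r S + r S + 2 <= r A + r (S :\ e :\: A) + r (e |: C) + r (e |: (S :\ e :\: C)))%N.
Proof.
move=> /rank_connectedP conn Se AS CS; set B := S :\ e :\: A; set D := S :\ e :\: C.
move=> nAC nBD.
have notin (X : {set E}) : X \subset S :\ e -> e \notin X.
  by move=> /subsetP XS; apply/negP => /XS; rewrite !inE eqxx.
have XS (X : {set E}) : X \subset S :\ e -> X \subset S.
  by move=> /subset_trans-> //; apply: subsetDl.
have conn' (X Y : {set E}) : X \subset S :\ e -> X != set0 -> S :\: X = Y ->
    (r S < r X + r Y)%N.
  move=> XSe nX <-; apply: conn => //; first exact: XS.
  by apply: contraNneq (notin X XSe) => ->.
have eA := notin _ AS; have eC := notin _ CS.
have AS' := XS _ AS; have CS' := XS _ CS.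
have h1 : (r S < r (A :&: C) + r (B :|: (e |: D)))%N.
  apply: conn' => //; first by rewrite (subset_trans _ AS) ?subsetIl.
  apply/setP => x; rewrite /B /D !inE; have := subsetP AS' x; have := subsetP CS' x.
  case: (eqVneq x e) => [->|_]; first by rewrite (negPf eA) Se /= ?orbT.
  by case: (x \in A) (x \in C) (x \in S) => [] [] [] //= a b;
    (discriminate (a isT) || discriminate (b isT)).
have h2 : (r S < r (B :&: D) + r (A :|: (e |: C)))%N.
  apply: conn' => //; first by rewrite (subset_trans (subsetIl _ _)) ?subsetDl.
  apply/setP => x; rewrite /B /D !inE; have := subsetP AS' x; have := subsetP CS' x.
  case: (eqVneq x e) => [->|_]; first by rewrite Se /= ?andbF ?orbT.
  by case: (x \in A) (x \in C) (x \in S) => [] [] [] //= a b;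
    (discriminate (a isT) || discriminate (b isT)).
have := rank_submod rank_r A (e |: C); have := rank_submod rank_r B (e |: D).
have -> : A :&: (e |: C) = A :&: C.
  by apply/setP => x; rewrite !inE; case: eqP => [->|//]; rewrite (negPf eA).
have -> : B :&: (e |: D) = B :&: D.
  by apply/setP => x; rewrite /B /D !inE; case: eqP => [->|//]; rewrite /= !andbF.
by move: h1 h2; lia.
Qed.

(** Suppose that [A] separates the deletion of [e] and [C] its contraction, and
    let [B] and [D] be their complements.  Adding the two rank conditions
    contradicts [uncrossing], unless [A :&: C] or [B :&: D] is empty, and unless
    [A :&: D] or [B :&: C] is empty; but any two of these empty intersections
    leave one of the four sets empty. *)
Lemma connected_minor S e : rank_connected r S -> e \in S -> r [set e] = 1%N ->
  r (S :\ e) = r S ->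
  rank_connected r (S :\ e) \/ rank_connected (contraction r e) (S :\ e).
Proof.
move=> conn Se re rSe; apply/orP; rewrite -[_ || _]negbK negb_or; apply/negP.
rewrite !negb_forall => /andP[/existsP[A]].
rewrite negb_imply -leqNgt => /andP[/andP[/andP[AS nA] nAS] rA] /existsP[C].
rewrite negb_imply -leqNgt => /andP[/andP[/andP[CS nC] nCS] rC].
move: rC; rewrite /contraction setD1K // re; set B := _ :\: A in rA *.
set D := _ :\: C => rC.
have DA : S :\ e :\: B = A by rewrite setDDr setDv set0U (setIidPr AS).
have DC : S :\ e :\: D = C by rewrite setDDr setDv set0U (setIidPr CS).
have eC := leq_rank_U1 e C; have eD := leq_rank_U1 e D.
have eS : (r [set e] <= r S)%N by rewrite (rank_mono rank_r) ?sub1set.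
have AC_BD : (A :&: C == set0) || (B :&: D == set0).
  rewrite -[_ || _]negbK negb_or; apply/negP => /andP[nAC nBD].
  by have := uncrossing conn Se AS CS nAC nBD; rewrite -/B -/D; lia.
have AD_BC : (A :&: D == set0) || (B :&: C == set0).
  rewrite -[_ || _]negbK negb_or; apply/negP => /andP[nAD nBC].
  have := uncrossing conn Se AS (subsetDl _ C) nAD.
  by rewrite DC => /(_ nBC); rewrite -/B -/D; lia.
have splitS (X Y : {set E}) : X \subset S :\ e -> X :&: Y = set0 ->
    X :&: (S :\ e :\: Y) = set0 -> X = set0.
  move=> XS XY XY'; apply/eqP; rewrite -subset0; apply/subsetP => x Xx.
  have /setP/(_ x) := XY; have /setP/(_ x) := XY'; rewrite !inE Xx.
  by have := subsetP XS x Xx; rewrite !inE => ->; case: (x \in Y).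
have nB : B != set0 by rewrite setD_eq0; apply: contra nAS => SA; rewrite eqEsubset AS.
have nD : D != set0 by rewrite setD_eq0; apply: contra nCS => SC; rewrite eqEsubset CS.
have BS : B \subset S :\ e := subsetDl _ _.
have DS : D \subset S :\ e := subsetDl _ _.
case/orP: AC_BD => /eqP X1; case/orP: AD_BC => /eqP X2.
- by case/eqP: nA; apply: (splitS A C).
- by case/eqP: nC; apply: (splitS C A); rewrite // setIC.
- by case/eqP: nD; apply: (splitS D A); rewrite // setIC.
by case/eqP: nB; apply: (splitS B C).
Qed.

End Rank.

(** * Tutte polynomials of rank functions *)

Definition tutte_poly (E : finType) (R : comNzRingType) (r : {set E} -> nat)
    (S : {set E}) (v : E -> R) : {poly R} :=
  \sum_(A : {set E} | A \subset S) (\prod_(e in A) v e) *: 'X^(r S - r A).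

Section TuttePoly.

Variables (E : finType) (R : comNzRingType).
Implicit Types (r : {set E} -> nat) (S A C : {set E}) (v : E -> R).

Lemma tutte_poly_map (R' : comNzRingType) (phi : {rmorphism R -> R'}) r S v :
  map_poly phi (tutte_poly r S v) = tutte_poly r S (phi \o v).
Proof.
rewrite rmorph_sum; apply: eq_bigr => A _ /=.
by rewrite map_polyZ rmorph_prod map_polyXn.
Qed.

Lemma eq_tutte_poly r S v u : {in S, v =1 u} -> tutte_poly r S v = tutte_poly r S u.
Proof.
move=> vu; apply: eq_bigr => A /subsetP AS; congr (_ *: _).
by apply: eq_bigr => f /AS; apply: vu.
Qed.

Lemma tutte_poly_delcon r S v e : rank_function r -> e \in S -> r [set e] = 1%N ->
    r (S :\ e) = r S ->
  tutte_poly r S v =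
    tutte_poly r (S :\ e) v + v e *: tutte_poly (contraction r e) (S :\ e) v.
Proof.
move=> rank_r Se re rSe; rewrite /tutte_poly (bigID (fun A : {set E} => e \in A)) addrC /=.
congr (_ + _); last first.
  by rewrite rSe; apply: eq_bigl => A; rewrite subsetD1.
rewrite (reindex_onto (fun A => e |: A) (fun A => A :\ e)) /=; last first.
  by move=> A /andP[_ Ae]; rewrite setD1K.
rewrite scaler_sumr; apply: eq_big => [A|A /andP[/andP[AS _] /eqP DA]].
  rewrite setU11 andbT subUset sub1set Se /= subsetD1; congr (_ && _).
  apply/eqP/idP => [<-|eA]; first by rewrite !inE eqxx.
  by rewrite setU1K.
have eA : e \notin A by rewrite -DA !inE eqxx.
rewrite big_setU1 // scalerA; congr (_ *: 'X^_).
by have := leq_rank_U1 rank_r e A; rewrite /contraction setD1K // re; lia.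
Qed.

Lemma size_tutte_poly r S v : (size (tutte_poly r S v) <= (r S).+1)%N.
Proof.
apply: (big_ind (fun q : {poly R} => (size q <= (r S).+1)%N)).
- by rewrite size_poly0.
- by move=> p1 p2 le1 le2; rewrite (leq_trans (size_polyD _ _)) // geq_max le1.
by move=> A _; rewrite (leq_trans (size_scale_leq _ _)) // size_polyXn ltnS leq_subr.
Qed.

Lemma tutte_poly_monic r S v : rank_function r ->
    (forall f, f \in S -> r [set f] = 1%N) ->
  tutte_poly r S v \is monic /\ size (tutte_poly r S v) = (r S).+1.
Proof.
move=> rank_r loopless; rewrite /tutte_poly (bigD1 set0) ?sub0set //=.
rewrite big_set0 scale1r (rank0 rank_r) subn0.
set p := \sum_(A | _) _; have sz : (size p < size ('X^(r S) : {poly R}))%N.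
  rewrite size_polyXn ltnS; apply: (big_ind (fun q : {poly R} => (size q <= r S)%N)).
  - by rewrite size_poly0.
  - by move=> p1 p2 le1 le2; rewrite (leq_trans (size_polyD _ _)) // geq_max le1.
  move=> A /andP[AS /set0Pn[f Af]].
  rewrite (leq_trans (size_scale_leq _ _)) // size_polyXn.
  have rA : (0 < r A)%N.
    by rewrite -(loopless f) ?(subsetP AS) // (rank_mono rank_r) ?sub1set.
  by have := rank_mono rank_r AS; lia.
split; last by rewrite size_polyDl // size_polyXn.
by rewrite monicE lead_coefDl // lead_coefXn.
Qed.

Lemma tutte_poly_restrict r S C v : rank_function r -> C \subset S ->
    (forall f, f \in S -> f \notin C -> v f = 0) ->
  tutte_poly r S v = 'X^(r S - r C) * tutte_poly r C v.
Proof.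
move=> rank_r CS v0; rewrite /tutte_poly (bigID (fun A => A \subset C)) /=.
rewrite [X in _ + X]big1 ?addr0; last first.
  move=> A /andP[/subsetP AS /subsetPn[f Af Cf]].
  by rewrite (bigD1 f) //= v0 ?AS // mul0r scale0r.
rewrite mulr_sumr; apply: eq_big => [A|A /andP[AS AC]].
  by apply: andb_idl => /subset_trans; apply.
rewrite -scalerAr -exprD; congr (_ *: 'X^_).
by have := rank_mono rank_r AC; have := rank_mono rank_r CS; lia.
Qed.

Lemma prod_addX C v :
  \prod_(f in C) ('X + (v f)%:P) =
    \sum_(A : {set E} | A \subset C) (\prod_(f in A) v f) *: 'X^(#|C| - #|A|).
Proof.
pose F f : {poly R} := if f \in C then (v f)%:P else 0.
pose G f : {poly R} := if f \in C then 'X else 1.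
transitivity (\prod_f (F f + G f)).
  rewrite big_mkcond; apply: eq_bigr => f _; rewrite /F /G.
  by case: ifP; rewrite ?add0r // addrC.
rewrite bigA_distr (bigID (fun A : {set E} => A \subset C)) /= [X in _ + X]big1 ?addr0.
  apply: eq_bigr => A AC; rewrite (bigID (fun f => f \in A)) /= -mul_polyC rmorph_prod /=.
  congr (_ * _).
    by apply: eq_bigr => f Af; rewrite Af /F (subsetP AC).
  rewrite -cardsDS //.
  rewrite -prodr_const [RHS]big_mkcond [LHS]big_mkcond; apply: eq_bigr => f _.
  by rewrite /G inE; case: (f \in A).
move=> A /subsetPn[f Af C'f].
by rewrite (bigD1 f) //= Af /F (negPf C'f) mul0r.
Qed.

Lemma tutte_poly_free r C v : (forall A, A \subset C -> r A = #|A|) ->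
  tutte_poly r C v = \prod_(f in C) ('X + (v f)%:P).
Proof.
move=> free_C; rewrite prod_addX; apply: eq_bigr => A AC.
by rewrite !free_C.
Qed.

(** The factor [X] makes the exponents those of the product, except for [A = C],
    where the exponent is [1] rather than [0]. *)
Lemma tutte_poly_circuit r C v : (0 < #|C|)%N ->
    (forall A, A \proper C -> r A = #|A|) -> r C = #|C|.-1 ->
  'X * tutte_poly r C v =
    \prod_(f in C) ('X + (v f)%:P) + (\prod_(f in C) v f) *: ('X - 1).
Proof.
move=> C_gt0 free_C rC; rewrite prod_addX /tutte_poly.
rewrite (bigD1 C) // [in RHS](bigD1 C) //= !subnn expr0 mulrDr -scalerAr mulr1.
rewrite addrAC -scalerDr [1 + _]addrC subrK; congr (_ + _).
rewrite mulr_sumr; apply: eq_bigr => A; rewrite andbC -properEneq => AC.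
rewrite -scalerAr -exprS (free_C A) // rC; congr (_ *: 'X^_).
by have := proper_card AC; lia.
Qed.

End TuttePoly.

(** A minimal [C] with [e] in its closure is a circuit through [e], minus [e].
    If dropping [f] from [C] did not lower the rank, [e] would remain in the
    closure; by submodularity the rank then drops in every subset of [C] as well,
    so [C] is independent. *)
Lemma minimal_spanning (E : finType) (r : {set E} -> nat) (S : {set E}) (e : E) :
    rank_function r -> r [set e] = 1%N -> r (e |: S) = r S ->
  exists C : {set E}, [/\ C \subset S, r (e |: C) = r C,
    forall A : {set E}, A \subset C -> r A = #|A|
  & forall A : {set E}, A \proper C -> r (e |: A) = (r A).+1].
Proof.
move=> rank_r re rS; pose P := [pred C : {set E} | r (e |: C) == r C].
have [|C /minsetP[/eqP rC minC] CS] := @minset_exists _ P S; first exact/eqP.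
have properC (A : {set E}) : A \proper C -> r (e |: A) = (r A).+1.
  rewrite properEneq => /andP[nA AC].
  have : r (e |: A) != r A by apply: contraNneq nA => rA; apply/eqP/minC => //; apply/eqP.
  have := rank_U1 rank_r e A; have := rank_mono rank_r (subsetUr [set e] A).
  by rewrite re; lia.
exists C; split => // A.
have ltC f : f \in C -> (r (C :\ f) < r C)%N.
  move=> Cf; have := properC _ (properD1 Cf).
  by have := rank_mono rank_r (setUS [set e] (subsetDl C [set f])); rewrite rC; lia.
have [n] := ubnP #|A|; elim: n A => // n IHn A leA AC.
have [->|/set0Pn[f Af]] := eqVneq A set0; first by rewrite cards0 (rank0 rank_r).
have := rank_submod rank_r A (C :\ f).
have -> : A :&: (C :\ f) = A :\ f.
  by rewrite setIDA (setIidPl AC).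
have -> : A :|: (C :\ f) = C.
  by apply/setP => x; rewrite !inE; case: eqP => [->|_] /=;
    [rewrite Af (subsetP AC) | apply: orb_idl; apply: (subsetP AC)].
have := ltC f (subsetP AC f Af); have := cardsD1 f A; rewrite Af.
have IH := IHn (A :\ f); have := rank_U1 rank_r f (A :\ f).
rewrite setD1K // => h1 h2 h3 h4; move: IH h1 h4.
have := rank1 rank_r f; rewrite (subset_trans _ AC) ?subsetDl // => h5 IH.
by rewrite IH //; lia.
Qed.

Lemma tutte_poly_rel (E : finType) (A B : fieldType) (R : A -> B -> Prop)
    (r : {set E} -> nat) (S : {set E}) (v : E -> A) (u : E -> B) :
  partial_hom R -> (forall f, f \in S -> R (v f) (u f)) ->
  poly_rel R (tutte_poly r S v) (tutte_poly r S u).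
Proof.
move=> homR Rvu i; rewrite !coef_sum; apply: (phom_sum homR) => D /subsetP DS.
rewrite !coefZ !coefXn; apply: (phomM homR); last first.
  by case: (i == _); [apply: (phom1 homR) | apply: (phom0 homR)].
apply: (big_rec2 R) => [|f a b Df ab]; first exact: (phom1 homR).
by apply: (phomM homR) => //; apply/Rvu/DS.
Qed.

(** * Induction on the matroid *)

Lemma monic_size2 (F : fieldType) (w : {poly F}) : w \is monic -> size w = 2%N ->
  w = 'X + (w`_0)%:P.
Proof.
move=> mon_w sz; apply/polyP => -[|[|i]]; rewrite coefD coefX coefC /= ?add0r //.
  by move: (monicP mon_w); rewrite lead_coefE sz addr0.
by rewrite nth_default ?sz // addr0.
Qed.

(** Since [q] is monic, the quotient has its constant coefficient in [D]. *)
Lemma monic_linear_quotient (D : idomainType) (F : fieldType)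
    (phi : {rmorphism D -> F}) (p q : {poly D}) : injective phi ->
    p \is monic -> q \is monic -> size p = (size q).+1 ->
    map_poly phi q %| map_poly phi p ->
  exists b, p = ('X - b%:P) * q.
Proof.
move=> phi_inj mon_p mon_q sz /dvdpP[w Dw].
have mon_phiq : map_poly phi q \is monic by rewrite monic_map.
have mon_w : w \is monic by rewrite -(monicMr _ mon_phiq) -Dw monic_map.
have szphi (p1 : {poly D}) : size (map_poly phi p1) = size p1.
  by rewrite size_map_inj_poly ?rmorph0.
have sz_w : size w = 2%N.
  have := congr1 (size \o @polyseq _) Dw; rewrite /= size_Mmonic ?monic_neq0 //.
  rewrite !szphi sz; have := monic_neq0 mon_q; rewrite -size_poly_gt0.
  by move: (size q) (size w) => a b; lia.
have Dw' := monic_size2 mon_w sz_w.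
have Dn : size q = (size q).-1.+1 by rewrite prednK // size_poly_gt0 monic_neq0.
set n := (size q).-1 in Dn.
exists ((if n is m.+1 then q`_m else 0) - p`_n).
apply: (map_inj_poly phi_inj); rewrite ?rmorph0 //.
rewrite rmorphM /= map_polyXsubC Dw; congr (_ * _).
rewrite Dw' -polyCN; congr (_ + _%:P).
have := congr1 (fun p1 : {poly F} => p1`_n) Dw.
have cm (p1 : {poly D}) i : (map_poly phi p1)`_i = phi p1`_i by rewrite coef_map.
have q1 : (map_poly phi q)`_n = 1.
  by rewrite cm -lead_coefE (monicP mon_q) rmorph1.
rewrite [in X in _ = X]Dw' mulrDl coefD coefXM coefCM q1 mulr1 cm.
rewrite rmorphB opprB => ->.
by case: (n) => [|m]; rewrite /= ?cm ?rmorph0 ?subr0 ?add0r // addrC addKr.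
Qed.

Section GenericWeights.

Variables (E : finType) (K : fieldType).
Local Notation v := (@var E K).

Lemma var_eq (f g : E) : (v f == v g) = (f == g).
Proof.
rewrite /var tofrac_eq; apply/eqP/eqP => [|->//].
move/(congr1 (meval (fun i => (i == enum_rank f)%:R))); rewrite !mevalXU eqxx.
case: eqP => [/enum_rank_inj->//|_ /eqP]; by rewrite oner_eq0.
Qed.

Lemma var_neq0 (f : E) : v f != 0.
Proof.
rewrite /var tofrac_eq0; apply/eqP => /(congr1 (meval (fun _ => 1))).
by rewrite mevalXU meval0 => /eqP; rewrite oner_eq0.
Qed.

Lemma var_neqN1 (f : E) : v f + 1 != 0.
Proof.
rewrite /var -tofrac1 -tofracD tofrac_eq0; apply/eqP.
move/(congr1 (meval (fun _ => 0))).
by rewrite mevalD mevalXU meval0 meval1 add0r => /eqP; rewrite oner_eq0.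
Qed.

(** The quotient [X - b] has [b] polynomial in the variables, so the variables
    outside the set [C] of [minimal_spanning] can be set to [0].  On [C] the
    deletion is free and the contraction is a circuit, and evaluation at [- v_f]
    gives [b = - v_f] for every [f] in [C], although [C] has at least two
    elements, [e] being neither a loop nor parallel to another element. *)
Lemma contraction_not_dvd_deletion (r : {set E} -> nat) (S : {set E}) (e : E) :
    rank_function r -> r [set e] = 1%N -> r (e |: S) = r S ->
    (forall f, f \in S -> r [set f] = 1%N) ->
    (forall f, f \in S -> contraction r e [set f] = 1%N) ->
  ~~ (tutte_poly (contraction r e) S v %| tutte_poly r S v).
Proof.
move=> rank_r re reS loopless no_parallel; set r' := contraction r e.
have rank_r' : rank_function r' by apply: contraction_rank.
have [C [CS reC free_C proper_C]] := minimal_spanning rank_r re reS.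
have C_gt1 : (1 < #|C|)%N.
  rewrite ltnNge leq_eqVlt ltnS leqn0; apply/negP => /orP[/cards1P[f DC]|].
    have := no_parallel f; rewrite -sub1set -DC CS => /(_ isT).
    have := rank1 rank_r f; rewrite /contraction -DC reC re; lia.
  by rewrite cards_eq0 => /eqP DC; move: reC; rewrite DC setU0 re (rank0 rank_r).
have rC : r C = #|C| by apply: free_C.
have rCS := rank_mono rank_r CS.
have r'C : r' C = #|C|.-1 by rewrite /r' /contraction reC rC re subn1.
have r'S : r' S = (r S).-1 by rewrite /r' /contraction reS re subn1.
have free'_C (A : {set E}) : A \proper C -> r' A = #|A|.
  by move=> AC; rewrite /r' /contraction proper_C // re subn1 free_C // proper_sub.
pose x f : {mpoly K[#|E|]} := 'X_(enum_rank f).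
have [mon_P0 sz_P0] := tutte_poly_monic x rank_r loopless.
have [mon_Q0 sz_Q0] := tutte_poly_monic x rank_r' no_parallel.
set P0 := tutte_poly r S x in mon_P0 sz_P0; set Q0 := tutte_poly r' S x in mon_Q0 sz_Q0.
pose tf : {rmorphism {mpoly K[#|E|]} -> ratfun E K} :=
  @FracField.tofrac {mpoly K[#|E|]}.
have tf_inj : injective tf by move=> a b /eqP; rewrite tofrac_eq => /eqP.
have DP : tutte_poly r S v = map_poly tf P0 by rewrite tutte_poly_map.
have DQ : tutte_poly r' S v = map_poly tf Q0 by rewrite tutte_poly_map.
apply/negP => dvdQP.
have [b0 Db0] : exists b0, P0 = ('X - b0%:P) * Q0.
  have dvd0 : map_poly tf Q0 %| map_poly tf P0 by rewrite -DP -DQ.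
  have sz0 : size P0 = (size Q0).+1 by rewrite sz_P0 sz_Q0 r'S; lia.
  exact: (@monic_linear_quotient _ _ tf P0 Q0 tf_inj mon_P0 mon_Q0 sz0 dvd0).
(* [rho] sets the variables outside [C] to [0]. *)
pose rho : {rmorphism {mpoly K[#|E|]} -> ratfun E K} :=
  mmap (tf \o @mpolyC #|E| K)
    (fun i => if enum_val i \in C then v (enum_val i) else 0).
have rho_x f : rho (x f) = if f \in C then v f else 0.
  by rewrite /rho /= mmapX mmap1U enum_rankK.
have := congr1 (map_poly rho) Db0; rewrite rmorphM /= map_polyXsubC !tutte_poly_map.
rewrite !(tutte_poly_restrict _ CS) //; last 2 first.
- by move=> f _ /negPf C'f; rewrite /= rho_x C'f.
- by move=> f _ /negPf C'f; rewrite /= rho_x C'f.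
have -> : (r' S - r' C = r S - r C)%N by rewrite r'S r'C rC; lia.
have eqC (r1 : {set E} -> nat) : tutte_poly r1 C (rho \o x) = tutte_poly r1 C v.
  by apply: eq_tutte_poly => f Cf; rewrite /= rho_x Cf.
rewrite !eqC mulrCA => /(mulfI (monic_neq0 (monicXn _ _))) {eqC}.
move/(congr1 (fun p => 'X * p)); rewrite mulrCA (tutte_poly_free _ free_C).
rewrite tutte_poly_circuit ?(ltnW C_gt1) //; set b := rho b0 => eq_b.
have Db f : f \in C -> b = - v f.
  move=> Cf; have := congr1 (fun p : {poly _} => p.[- v f]) eq_b.
  have prod0 : (\prod_(g in C) ('X + (v g)%:P)).[- v f] = 0.
    by rewrite (bigD1 f) //= hornerM hornerD hornerX hornerC addNr mul0r.
  have nz_prod : \prod_(g in C) v g != 0 by apply/prodf_neq0 => g _; apply: var_neq0.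
  rewrite -polyC1 !(hornerM, hornerD, hornerX, hornerN, hornerC, hornerZ) prod0.
  rewrite mulr0 add0r -(opprD (v f) 1) => /esym/eqP; rewrite !mulf_eq0 oppr_eq0.
  by rewrite (negPf (var_neqN1 f)) (negPf nz_prod) !orbF subr_eq0 => /eqP.
have /card_gt1P[f [g [Cf Cg fg]]] := C_gt1.
by case/negP: fg; rewrite -var_eq -eqr_opp -!Db.
Qed.

End GenericWeights.

(** In rank [1] the polynomial is linear.  Otherwise any element [e] is neither a
    loop nor a coloop, and the pencil spanned by the deletion and the contraction
    of [e] is full by one of the two places [v_e = 0] and [v_e = oo]. *)
Lemma full_galois_tutte_poly (E : finType) (K : fieldType) (r : {set E} -> nat)
    (S : {set E}) :
  rank_function r -> rank_connected r S -> (0 < r S)%N ->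
  full_galois (tutte_poly r S (@var E K)).
Proof.
have [n] := ubnP #|S|; elim: n => // n IHn in r S *; rewrite ltnS => leS.
move=> rank_r conn rS; set v := @var E K.
have loopless f : f \in S -> r [set f] = 1%N by apply: connected_loopless.
have [mon_Z sz_Z] := tutte_poly_monic v rank_r loopless.
have [rS1|rS_gt1] := leqP (r S) 1.
  by apply: full_galois_linear; rewrite sz_Z; congr _.+1; lia.
have /set0Pn[e Se] : S != set0.
  by apply: contraTneq rS => ->; rewrite (rank0 rank_r).
have nS : S != [set e].
  by apply: contraTneq rS_gt1 => ->; rewrite -leqNgt (rank1 rank_r).
have re := loopless e Se; have rSe := connected_coloopless rank_r conn Se nS.
have ltS : (#|S :\ e| < n)%N by move: leS; rewrite (cardsD1 e S) Se.
have loopless' f : f \in S :\ e -> r [set f] = 1%N.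
  by rewrite inE => /andP[_]; apply: loopless.
have rank_r' := contraction_rank rank_r e.
have r'S : contraction r e (S :\ e) = (r S).-1.
  by rewrite /contraction setD1K // re subn1.
set P := tutte_poly r (S :\ e) v; pose Q := tutte_poly (contraction r e) (S :\ e) v.
have DZ : tutte_poly r S v = P + v e *: Q by apply: tutte_poly_delcon.
have [mon_P sz_P] : P \is monic /\ size P = (r S).+1.
  by rewrite -rSe; apply: tutte_poly_monic.
have [R [homR valR Re Rf]] := generic_variable K e.
apply: (full_galois_specialize homR valR mon_Z
  (f' := map_poly (@fraction_const _) P +
    FracField.tofrac 'X *: map_poly (@fraction_const _) Q)).
  rewrite DZ; apply: (prelD homR); last apply: (prelZ homR Re).
    by rewrite tutte_poly_map; apply: tutte_poly_rel => // f;
      rewrite !inE => /andP[fe _]; apply: Rf.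
  by rewrite tutte_poly_map; apply: tutte_poly_rel => // f;
      rewrite !inE => /andP[fe _]; apply: Rf.
have [conn'|conn'] := connected_minor rank_r conn Se re rSe.
  have full_P : full_galois P.
    by have := IHn r (S :\ e) ltS rank_r conn'; rewrite rSe; apply.
  apply: (full_galois_pencil0 mon_P _ full_P).
  rewrite sz_P ltnS -(prednK rS) -r'S; exact: size_tutte_poly.
have r'S_gt0 : (0 < contraction r e (S :\ e))%N by rewrite r'S; lia.
have loopless_r' f : f \in S :\ e -> contraction r e [set f] = 1%N.
  exact: connected_loopless.
have [mon_Q sz_Q] := tutte_poly_monic v rank_r' loopless_r'.
have full_Q : full_galois Q := IHn (contraction r e) (S :\ e) ltS rank_r' conn' r'S_gt0.
rewrite -/Q in mon_Q sz_Q; have Q_gt1 : (1 < size Q)%N by rewrite sz_Q.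
have size_PQ : size P = (size Q).+1 by rewrite sz_P sz_Q r'S prednK.
have co_PQ : coprimep P Q.
  rewrite coprimep_sym (irreducible_poly_coprime P); last first.
    exact: full_galois_irreducible mon_Q Q_gt1 full_Q.
  apply: (contraction_not_dvd_deletion K rank_r re _ loopless' loopless_r').
  by rewrite setD1K.
exact: full_galois_pencil_oo mon_P mon_Q size_PQ Q_gt1 co_PQ full_Q.
Qed.

Lemma mv_tutteE (E : finType) (M : matroid E) (K : fieldType) :
  mv_tutte M K = tutte_poly (mrank M) [set: E] (@var E K).
Proof. by apply: eq_bigl => A; rewrite subsetT. Qed.

Theorem theorem1 (E : finType) (M : matroid E) (K : fieldType)
    (M_connected : mconnected M) (rk_gt0 : (0 < rk M)%N)
    (L : splittingFieldType (ratfun E K))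
    (L_splits : splittingFieldFor 1 (map_poly (in_alg L) (mv_tutte M K)) {:L}) :
  exists rs : (rk M).-tuple L,
    [/\ uniq rs,
        root (map_poly (in_alg L) (mv_tutte M K)) =i rs
      & gal_perms rs = [set: 'S_(rk M)]].
Proof.
have rank_M := mrank_rank_function M; have conn_M := mconnected_rank M_connected.
have [|mon_Z sz_Z] := tutte_poly_monic (@var E K) rank_M (S := [set: E]).
  by move=> f _; apply: connected_loopless (in_setT f).
have full_Z := @full_galois_tutte_poly E K _ _ rank_M conn_M rk_gt0.
rewrite -mv_tutteE in mon_Z sz_Z full_Z.
exact: full_galois_group mon_Z sz_Z full_Z L_splits.
Qed.
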